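(* Let $X=\Sigma_{\boldsymbol a}\times G$, where $\Sigma_{\boldsymbol a}$ is the $\boldsymbol a$-adic solenoid with $\boldsymbol a=(2,3,4,\dots)$, and $G$ is a finite Abelian group containing no elements of order $2$. Let $\alpha$ be a topological automorphism of $X$; it has the form $\alpha(z,g)=(az,\alpha_G g)$ for $z\in\Sigma_{\boldsymbol a}$, $g\in G$, where $a$ is a nonzero rational number and $\alpha_G$ is an automorphism of $G$. Set $K=\mathrm{Ker}(I+\alpha_G)\subset G$. Let $\xi_1$ and $\xi_2$ be independent random variables with values in $X$ and distributions $\mu_1$ and $\mu_2$ whose characteristic functions do not vanish anywhere on the character group of $X$. Assume that the conditional distribution of the linear form $L_2=\xi_1+\alpha\xi_2$ given $L_1=\xi_1+\xi_2$ is symmetric. If $a\neq-1$, then $\mu_j=\gamma_j*\omega*E_{x_j}$, $j=1,2$, where $\gamma_j$ is a Gaussian distribution on $\Sigma_{\boldsymbol a}$ (regarded as the subgroup $\Sigma_{\boldsymbol a}\times\{0\}$), $\omega$ is a distribution supported in $K$, and $x_j\in X$. If $a=-1$, then $\mu_j=\omega*E_{x_j}$, $j=1,2$, where $\omega$ is a distribution supported in $\Sigma_{\boldsymbol a}\times K$ and $x_j\in X$.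
   Context: The $\boldsymbol a$-adic solenoid $\Sigma_{\boldsymbol a}$ with $\boldsymbol a=(2,3,4,\dots)$ is the compact connected one-dimensional Abelian group whose character group is the additive group $\mathbb{Q}$ of rationals with the discrete topology (equivalently, the Pontryagin dual of discrete $\mathbb{Q}$); it is torsion-free and uniquely divisible, so multiplication by a nonzero rational is a topological automorphism, and all its topological automorphisms are of this form. For a locally compact Abelian group $X$ with character group $Y$, the characteristic function of a probability distribution $\mu$ is $\hat\mu(y)=\int_X(x,y)\,d\mu(x)$, where $(x,y)$ is the value of the character $y$ at $x$. $E_x$ is the degenerate distribution at $x$ and $*$ is convolution. A Gaussian distribution on $\Sigma_{\boldsymbol a}$ is one whose characteristic function is $\hat\gamma(r)=(z,r)\exp\{-\sigma r^2\}$, $r\in\mathbb{Q}$, with $z\in\Sigma_{\boldsymbol a}$, $\sigma\ge0$. ''The conditional distribution of $L_2$ given $L_1$ is symmetric'' means that the random vectors $(L_1,L_2)$ and $(L_1,-L_2)$ have the same distribution. *)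

(* Defs.v *)
From HB Require Import structures.
From mathcomp Require Import all_boot all_order all_algebra.
From mathcomp Require Import all_classical all_reals all_analysis.
From mathcomp Require Import finalg ring lra.
Set Implicit Arguments. Unset Strict Implicit. Unset Printing Implicit Defensive.
Import Order.TTheory GRing.Theory Num.Theory.
Local Open Scope classical_set_scope.
Local Open Scope ring_scope.

(* The a-adic solenoid Sigma_a, a = (2,3,4,...), realised as the Pontryagin  *)
(* dual of the discrete group Q: an element x is a homomorphism Q -> R/Z,    *)
(* stored through its canonical representatives x r in [0,1).                *)

Section Solenoid.
Variable R : realType.

Definition frac (t : R) : R := t - (Num.floor t)%:~R.

Lemma frac_ge0 t : 0 <= frac t.
Proof. by rewrite /frac subr_ge0 Num.Theory.floor_le. Qed.

Lemma frac_lt1 t : frac t < 1.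
Proof. by rewrite /frac ltrBlDl -[_ + 1]intrD1 ?Num.Theory.floorD1_gt //; rewrite addrC intrD. Qed.

Definition is_sol (x : rat -> R) : Prop :=
  (forall r, 0 <= x r < 1) /\
  (forall r s, x (r + s) - x r - x s \is a Num.int).

Record solenoid := Solenoid { solv : rat -> R ; solP : is_sol solv }.

Lemma is_sol0 : is_sol (fun _ => 0).
Proof. by split => [r|r s]; rewrite ?lexx ?ltr01 // !subr0 rpred0. Qed.

Definition sol0 : solenoid := @Solenoid _ is_sol0.

HB.instance Definition _ := gen_eqMixin solenoid.
HB.instance Definition _ := gen_choiceMixin solenoid.
HB.instance Definition _ := isPointed.Build solenoid sol0.

Lemma is_sol_add (x y : solenoid) : is_sol (fun r => frac (solv x r + solv y r)).
Proof.
case: x y => [x [_ hx]] [y [_ hy]] /=; split => [r|r s].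
  by rewrite frac_ge0 frac_lt1.
rewrite /frac.
set a := Num.floor _; set b := Num.floor _; set c := Num.floor _.
have -> : x (r + s) + y (r + s) - a%:~R - (x r + y r - b%:~R) - (x s + y s - c%:~R)
   = (x (r + s) - x r - x s) + (y (r + s) - y r - y s) - (a%:~R - b%:~R - c%:~R).
  by ring.
apply: rpredB; first exact: rpredD. by apply: rpredB; [apply: rpredB|]; exact: intr_int.
Qed.

Definition sol_add (x y : solenoid) : solenoid := @Solenoid _ (is_sol_add x y).

Lemma is_sol_opp (x : solenoid) : is_sol (fun r => solv x (- r)).
Proof.
case: x => [x [h1 h2]] /=; split => [r|r s]; first exact: h1.
by rewrite opprD h2.
Qed.

Definition sol_opp (x : solenoid) : solenoid := @Solenoid _ (is_sol_opp x).

(* multiplication by a rational a: it is the dual of r |-> a r on Q *)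
Lemma is_sol_scale (a : rat) (x : solenoid) : is_sol (fun r => solv x (a * r)).
Proof.
case: x => [x [h1 h2]] /=; split => [r|r s]; first exact: h1.
by rewrite mulrDr h2.
Qed.

Definition sol_scale (a : rat) (x : solenoid) : solenoid :=
  @Solenoid _ (is_sol_scale a x).

(* Borel sigma-algebra of the solenoid: generated by the coordinate maps     *)
(* x |-> x(r) (Q is countable, so this is the Borel sigma-algebra of the     *)
(* compact metrizable group Hom(Q, R/Z) with the pointwise topology).        *)
Definition sol_gen : set (set solenoid) :=
  [set A | exists r : rat, exists2 B : set R, measurable B &
     A = (fun x => solv x r) @^-1` B].

End Solenoid.

Notation Sol R := (g_sigma_algebraType (@sol_gen R)).

Section Discrete.
Variable G : finZmodType.
Definition discr : Type := G.
HB.instance Definition _ := Choice.on discr.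
HB.instance Definition _ := isPointed.Build discr (0 : G).
HB.instance Definition _ := @isMeasurable.Build default_measure_display
  discr discrete_measurable discrete_measurable0
  discrete_measurableC discrete_measurableU.
End Discrete.

Section GroupX.
Variables (R : realType) (G : finZmodType).

Local Notation X := (Sol R * discr G)%type.

Definition X_add (x y : X) : X := (sol_add x.1 y.1, (x.2 : G) + (y.2 : G) : G).
Definition X_opp (x : X) : X := (sol_opp x.1, - (x.2 : G) : G).

Definition X_aut (a : rat) (alphaG : G -> G) (x : X) : X :=
  (sol_scale a x.1, alphaG x.2 : G).

Definition sol_embed (z : Sol R) : X := (z, 0 : G).

(* character of X indexed by (r, chi) in Q x G^, where chi : G -> R is a    *)
(* homomorphism G -> R/Z (given by any lift); its "angle" at x, so that the *)
(* value of the character at x is exp(2 pi i * X_angle r chi x).            *)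
Definition is_charG (chi : G -> R) : Prop :=
  forall g h : G, chi (g + h) - chi g - chi h \is a Num.int.

Definition X_angle (r : rat) (chi : G -> R) (x : X) : R :=
  solv x.1 r + chi x.2.

Definition charfun_vanishes_at (mu : set X -> \bar R) (r : rat) (chi : G -> R) : Prop :=
  (\int[mu]_x (cos (2 * pi * X_angle r chi x))%:E = 0)%E /\
  (\int[mu]_x (sin (2 * pi * X_angle r chi x))%:E = 0)%E.

Definition X_conv (m1 m2 : set X -> \bar R) : set X -> \bar R :=
  fun A => (m1 \x m2)%E [set p | X_add p.1 p.2 \in A].

End GroupX.

Notation X R G := (Sol R * discr G)%type.

(* Gaussian distribution on the solenoid:                                   *)
(*   gamma^(r) = (z, r) exp(-sigma r^2),  z in Sigma_a,  sigma >= 0,         *)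
(* with (z, r) = exp(2 pi i z(r)), written via real and imaginary parts.    *)
Definition gaussian_sol (R : realType) (gam : set (Sol R) -> \bar R) : Prop :=
  exists (z : Sol R) (sigma : R), 0 <= sigma /\
    forall r : rat,
      (\int[gam]_x (cos (2 * pi * solv x r))%:E
         = (cos (2 * pi * solv z r) * expR (- sigma * (ratr r) ^+ 2))%:E)%E /\
      (\int[gam]_x (sin (2 * pi * solv x r))%:E
         = (sin (2 * pi * solv z r) * expR (- sigma * (ratr r) ^+ 2))%:E)%E.

(* Main.v *)
Require Import Defs.
From HB Require Import structures.
From mathcomp Require Import all_boot all_order all_algebra.
From mathcomp Require Import all_classical all_reals all_analysis.
From mathcomp Require Import finalg.
From mathcomp Require Import measurable_realfun ring lra.
From mathcomp.real_closed Require Import complex.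
From mathcomp Require fingroup cyclic cyclotomic algC classfun character.
Import Order.TTheory GRing.Theory Num.Theory.
Import numFieldNormedType.Exports.
Local Open Scope classical_set_scope.
Local Open Scope ring_scope.

(* Write Y = Q x G^ for the dual group, b for the adjoint of alpha, f_j for the
   characteristic functions, A = 1 - b and B = 1 + b.  Independence turns the
   symmetry hypothesis into the Heyde equation
     f_1(u + v) f_2(u + b v) = f_1(u - v) f_2(u - b v),
   which for u = x + y, v = x - y gives f_1(2x) = f_2(Ax) / f_2(Bx) and, for
   S(p, q) = f_2(p + q) / (f_2(p) f_2(q)), the identity S(Bx, Ay) = S(Ax, By).
   As A and B commute and B^2 - A^2 = 4b is onto, this forces S(Bx, .) to be
   multiplicative wherever A is onto; the part of Y where A is nilpotent is
   harmless, because |f_2| = 1 there.  No theorem of Marcinkiewicz type is needed: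
   third differences vanish outright.  On torsion elements multiplicativity gives
   |f_2(Bx)| = 1, so g + alpha_G g is almost surely constant under mu_2; on Q,
   if a <> -1, S is a positive bimultiplicative function, hence
   exp(-2 sigma r s), and the solenoid marginals are Gaussian, while the two
   components of each mu_j are independent since a divisible and a torsion
   element pair trivially under S.  The distributions are then recovered from
   their characteristic functions, gamma_j and omega being (translated)
   marginals of mu_j and mu_2. *)

Set Implicit Arguments. Unset Strict Implicit. Unset Printing Implicit Defensive.
Local Open Scope complex_scope.

(** * Differences of the logarithm, written multiplicatively *)

Section Cocycle.
Variables (Y : zmodType) (C : fieldType) (f : Y -> C).
Hypothesis f_neq0 : forall p, f p != 0.

Definition cocycle (p q : Y) : C := f (p + q) / (f p * f q).
Definition cocycle3 (p q r : Y) : C :=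
  cocycle p (q + r) / (cocycle p q * cocycle p r).

Lemma cocycleC p q : cocycle p q = cocycle q p.
Proof. by rewrite /cocycle addrC [f p * _]mulrC. Qed.

Lemma cocycle_neq0 p q : cocycle p q != 0.
Proof. by rewrite /cocycle mulf_neq0 ?invr_neq0 ?mulf_neq0. Qed.

Lemma cocycleE p q : f (p + q) = f p * f q * cocycle p q.
Proof. by rewrite /cocycle mulrC divfK // mulf_neq0. Qed.

(** The expanded third difference is visibly symmetric in [p], [q], [r], which the nested definition
    hides. *)
Lemma cocycle3E p q r : cocycle3 p q r =
  f (p + q + r) * f p * f q * f r / (f (p + q) * f (p + r) * f (q + r)).
Proof.
by rewrite /cocycle3 /cocycle addrA; field; rewrite !f_neq0.
Qed.

Lemma cocycle3C p q r : cocycle3 p q r = cocycle3 q p r.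
Proof. by rewrite !cocycle3E [p + q]addrC; congr (_ / _); ring. Qed.

Lemma cocycle3AC p q r : cocycle3 p q r = cocycle3 p r q.
Proof. by rewrite /cocycle3 [q + r]addrC [cocycle p q * _]mulrC. Qed.

(** Lets an argument of [cocycle] be replaced by one in the image of [A], up to elements where [f]
    has modulus 1. *)
Definition cocycle_eqv p p' := forall q, cocycle p q = cocycle p' q.

Lemma cocycle3_eqv p p' q r :
  cocycle_eqv p p' -> cocycle3 p q r = cocycle3 p' q r.
Proof. by move=> e; rewrite /cocycle3 !e. Qed.

(** For fixed [p], [cocycle3 p] is the coboundary of [cocycle p]; this is its 2-cocycle identity. *)
Lemma cocycle3_swap p q q' r :
  cocycle3 p q (q' + r) * cocycle3 p q' r = cocycle3 p (q + q') r * cocycle3 p q q'.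
Proof.
rewrite /cocycle3 !addrA.
by field; rewrite !cocycle_neq0.
Qed.

Variable b : Y -> Y.
Hypothesis bD : {morph b : x y / x + y}.
Let A x := x - b x.
Let B x := x + b x.

Lemma morphD0 : b 0 = 0.
Proof. by apply: (addrI (b 0)); rewrite -bD !addr0. Qed.

Lemma morphDN x : b (- x) = - b x.
Proof. by apply/eqP; rewrite -addr_eq0 -bD addNr morphD0. Qed.

Let AD x y : A (x + y) = A x + A y.
Proof. by rewrite /A bD opprD addrACA. Qed.
Let BD x y : B (x + y) = B x + B y.
Proof. by rewrite /B bD addrACA. Qed.
Let AB x : A (B x) = B (A x).
Proof. by rewrite /A /B !bD morphDN !opprD !addrA addrK addrNK. Qed.

Hypothesis cocycle_heyde : forall x y, cocycle (B x) (A y) = cocycle (A x) (B y).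

Lemma cocycle3_heyde x y z :
  cocycle3 (B x) (A y) (A z) = cocycle3 (A x) (B y) (B z).
Proof. by rewrite /cocycle3 -AD -BD !cocycle_heyde. Qed.

(** [cocycle3_heyde] is applied twice, with the first and then the second argument in front. Each
    use exchanges one [A] with one [B] in every argument, so the first two arguments are restored
    and the third goes from [A (A z)] to [B (B z)]. *)
Lemma cocycle3_heyde2 x y z :
  cocycle3 (A (B x)) (A y) (A (A z)) = cocycle3 (A (B x)) (A y) (B (B z)).
Proof.
rewrite AB cocycle3_heyde -AB cocycle3C.
by rewrite cocycle3_heyde cocycle3C -AB.
Qed.

Lemma sqrB_sub_sqrA x : B (B x) + A (A (- x)) = b x *+ 4.
Proof.
rewrite /A /B !(bD, morphDN) !opprD !opprK !addrA.
set u := b x; set v := b u.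
rewrite [_ + v - x]addrAC [x + u + u - x]addrAC [x + u - x]addrAC subrr add0r.
rewrite [u + u + v + u + u - v]addrAC [u + u + v + u - v]addrAC addrK.
by rewrite !mulrS mulr0n addr0 !addrA.
Qed.

Lemma cocycle3_neq0 p q r : cocycle3 p q r != 0.
Proof.
by apply: mulf_neq0; [|apply: invr_neq0; apply: mulf_neq0]; apply: cocycle_neq0.
Qed.

Hypothesis f0 : f 0 = 1.

Lemma cocycle0 p : cocycle p 0 = 1.
Proof. by rewrite /cocycle addr0 f0 mulr1 divff. Qed.

Lemma cocycle3_0 p q : cocycle3 p q 0 = 1.
Proof. by rewrite /cocycle3 addr0 cocycle0 mulr1 divff ?cocycle_neq0. Qed.

(** Expanding the third argument by [cocycle3_swap] leaves [A (A z)] only next to second arguments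
    in the image of [A], where [cocycle3_heyde2] turns it into [B (B z)]. So the sum
    [A (A (- z)) + A (A z) = 0] may be replaced by [A (A (- z)) + B (B z)], which is four times
    [b z]. *)
Lemma cocycle3_heyde_eq1 x y z : cocycle3 (A (B x)) (A y) (b z *+ 4) = 1.
Proof.
have e w t : cocycle3 (A (B x)) (A y) (A w + t) =
    cocycle3 (A (B x)) (A y + A w) t * cocycle3 (A (B x)) (A y) (A w) /
    cocycle3 (A (B x)) (A w) t.
  by rewrite -cocycle3_swap mulfK ?cocycle3_neq0.
have := e (A (- z)) (A (A z)).
rewrite -[A y + _]AD !(cocycle3_heyde2 _ _ z) AD -e.
rewrite -AD -AD addNr [A (A (-z)) + _]addrC sqrB_sub_sqrA => <-.
by rewrite /A morphD0 subr0 morphD0 subr0 cocycle3_0.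
Qed.

Lemma cocycle_heydeD :
  (forall x, exists x', cocycle_eqv x (A x') /\ cocycle_eqv (B x) (B (A x'))) ->
  (forall z, exists z', cocycle_eqv z (b z' *+ 4)) ->
  forall x y z, cocycle (B x) (y + z) = cocycle (B x) y * cocycle (B x) z.
Proof.
move=> hA h4 x y z.
have [x' [_ ex]] := hA x; have [y' [ey _]] := hA y; have [z' ez] := h4 z.
have : cocycle3 (B x) y z = 1.
  rewrite (cocycle3_eqv _ _ ex) -AB.
  rewrite cocycle3C (cocycle3_eqv _ _ ey) cocycle3C.
  rewrite cocycle3AC cocycle3C (cocycle3_eqv _ _ ez) cocycle3C cocycle3AC.
  exact: cocycle3_heyde_eq1.
by move=> /divr1_eq.
Qed.
End Cocycle.

(** * The Heyde equation on an abelian group *)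

(* [cfl_unit] holds for characteristic functions because [`|f p| = 1] makes the
   character [p] almost surely constant. *)
Record charfun_like (Y : zmodType) (C : numClosedFieldType) (f : Y -> C) : Prop :=
  CharfunLike {
    cfl_0 : f 0 = 1;
    cfl_neq0 : forall p, f p != 0;
    cfl_N : forall p, f (- p) = (f p)^*%R;
    cfl_le1 : forall p, `|f p| <= 1;
    cfl_unit : forall p q, `|f p| = 1 -> f (p + q) = f p * f q }.

Section Heyde.
Variables (Y : zmodType) (C : numClosedFieldType) (f1 f2 : Y -> C) (b half : Y -> Y).
Hypotheses (cf1 : charfun_like f1) (cf2 : charfun_like f2).
Hypothesis bD : {morph b : x y / x + y}.
Hypothesis halfD : {morph half : x y / x + y}.
Hypothesis halfK : forall x, half x + half x = x.
Hypothesis heyde : forall u v,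
  f1 (u + v) * f2 (u + b v) = f1 (u - v) * f2 (u - b v).

Let A x := x - b x.
Let B x := x + b x.
Let S := cocycle f2.

Let n1 := cfl_neq0 cf1.
Let n2 := cfl_neq0 cf2.

Let AD : {morph A : x y / x + y}.
Proof. by move=> x y; rewrite /A bD opprD addrACA. Qed.
Let BD : {morph B : x y / x + y}.
Proof. by move=> x y; rewrite /B bD addrACA. Qed.
Let bN := morphDN bD.
Let AB x : A (B x) = B (A x).
Proof. by rewrite /A /B !bD bN !opprD !addrA addrK addrNK. Qed.

Let S0 p : S p 0 = 1. Proof. exact: cocycle0 n2 (cfl_0 cf2) p. Qed.

Lemma heyde_double x : f1 (x + x) * f2 (B x) = f2 (A x).
Proof. by rewrite heyde subrr (cfl_0 cf1) mul1r. Qed.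

Lemma heyde_cocycle x y : S (B x) (A y) = S (A x) (B y).
Proof.
have := heyde (x + y) (x - y).
have -> : x + y + (x - y) = x + x by rewrite addrACA subrr addr0.
have -> : x + y - (x - y) = y + y by rewrite opprB [x + y]addrC addrACA subrr addr0.
have -> : x + y + b (x - y) = B x + A y by rewrite bD bN addrACA.
have -> : x + y - b (x - y) = A x + B y by rewrite bD bN opprD opprK addrACA.
move=> h.
have e1 := heyde_double x; have e2 := heyde_double y.
rewrite /S /cocycle.
have : f1 (x + x) != 0 by [].
have : f1 (y + y) != 0 by [].
rewrite -e1 -e2; move: h.
move: (f1 (x + x)) (f1 (y + y)) => u v h v0 u0.
have -> : f2 (B x + A y) = v * f2 (A x + B y) / u by rewrite -h mulrC mulKf.
by field; rewrite u0 v0 !n2.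
Qed.

Lemma unit_add p q : `|f2 p| = 1 -> `|f2 q| = 1 -> `|f2 (p + q)| = 1.
Proof. by move=> hp hq; rewrite (cfl_unit cf2) // normrM hp hq mul1r. Qed.

(** In [heyde_double] two factors of modulus at most 1 have a product of modulus 1, so [f2 (B x)]
    has modulus 1 as well; and [x + x = A x + B x]. *)
Lemma unit_double x : `|f2 (A x)| = 1 -> `|f2 (x + x)| = 1.
Proof.
move=> hA; have := congr1 Num.norm (heyde_double x); rewrite hA normrM => h.
have l1 := cfl_le1 cf1 (x + x); have l2 := cfl_le1 cf2 (B x).
have hB : `|f2 (B x)| = 1.
  apply/eqP; rewrite eq_le l2 /= -h -[leRHS]mul1r.
  by rewrite ler_wpM2r.
have -> : x + x = A x + B x by rewrite /A /B addrACA addNr addr0.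
exact: unit_add.
Qed.

Let halfB x : half (b x) = b (half x).
Proof.
rewrite -{1}[x]halfK bD halfD; exact: halfK.
Qed.

Let halfA k x : iter k A (half x) = half (iter k A x).
Proof. by elim: k => //= k ->; rewrite /A halfD (morphDN halfD) halfB. Qed.

(** Halving commutes with [A], so [A (half x)] is killed one iteration earlier than [x]; the
    induction hypothesis and [unit_double] at [half x] conclude. *)
Lemma unit_ker k x : iter k A x = 0 -> `|f2 x| = 1.
Proof.
elim: k x => [|k IH] x; first by move=> /= ->; rewrite (cfl_0 cf2) normr1.
rewrite iterSr => h; rewrite -[x]halfK; apply: unit_double; apply: IH.
by rewrite -[A _]/(iter 1 A _) halfA halfA h (morphD0 halfD).
Qed.

Lemma unit_cocycle_eqv p n : `|f2 n| = 1 -> cocycle_eqv f2 (n + p) p.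
Proof.
move=> hn q; rewrite /cocycle -addrA !(cfl_unit cf2 _ hn).
by field; rewrite !n2.
Qed.

Hypothesis b_surj : forall y, exists x, b x = y.
Hypothesis A_fitting : forall x, exists x' k, iter k A (x - A x') = 0.

Lemma heyde_mult x y z : S (B x) (y + z) = S (B x) y * S (B x) z.
Proof.
apply: (cocycle_heydeD n2 bD heyde_cocycle (cfl_0 cf2)).
- move=> u; have [u' [k hk]] := A_fitting u; exists u'; split.
    rewrite -{1}[u](subrK (A u')); apply: unit_cocycle_eqv.
    exact: unit_ker hk.
  (* [B] commutes with [A], hence preserves the elements killed by a power of [A]. *)
  rewrite -/(B u) -{1}[u](subrK (A u')) BD; apply: unit_cocycle_eqv.
  apply: (@unit_ker k).
  have cAB w : iter k A (B w) = B (iter k A w).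
    by elim: k {hk} => //= k ->; rewrite AB.
  by rewrite cAB hk /B (morphD0 bD) addr0.
- move=> z0; have [z' hz'] := b_surj (half (half z0)); exists z'.
  by rewrite hz' -[4%N]/(2 * 2)%N mulrnA !mulr2n !halfK.
Qed.

(** The 2-cocycle identity of [S] carries multiplicativity from the second argument to the first. *)
Lemma heyde_multl x p q : S (B x + p) q = S (B x) q * S p q.
Proof.
have h : S (B x + p) q * S (B x) p = S (B x) (p + q) * S p q.
  by rewrite /S /cocycle addrA; field; rewrite !n2.
have n0 := cocycle_neq0 n2 (B x) p.
by apply: (mulIf n0); rewrite h heyde_mult -/S; ring.
Qed.

Lemma heyde_mulrn x q n : S (B x) (q *+ n) = S (B x) q ^+ n.
Proof.
elim: n => [|n IH]; first by rewrite mulr0n expr0 S0.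
by rewrite mulrS heyde_mult IH exprS.
Qed.

Lemma heyde_mulrnl x q n : S (B x *+ n) q = S (B x) q ^+ n.
Proof.
elim: n => [|n IH].
  by rewrite mulr0n expr0 /S cocycleC; exact: S0.
by rewrite mulrS heyde_multl IH exprS.
Qed.

(** By multiplicativity [S (B x) (B x)] is inverse to [S (B x) (- B x)], and the latter is the
    inverse of [f2 (B x)] times its conjugate. *)
Lemma heyde_diag x : S (B x) (B x) = `|f2 (B x)| ^+ 2.
Proof.
have := heyde_mult x (B x) (- B x).
rewrite subrr S0 {2}/S /cocycle subrr (cfl_0 cf2) (cfl_N cf2).
by rewrite -normCK div1r => /esym /divr1_eq.
Qed.

(** Here [1 = S (B x) (B x *+ n)] is the power [2 * n] of a nonnegative number. *)
Lemma heyde_torsion x n : (0 < n)%N -> B x *+ n = 0 -> `|f2 (B x)| = 1.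
Proof.
move=> n0 hn; have := heyde_mulrn x (B x) n.
rewrite hn S0 heyde_diag -exprM => /esym /eqP.
by rewrite pexpr_eq1 ?muln_gt0 ?n0 ?normr_ge0 // => /eqP.
Qed.

(** The factor [n] is moved from the first argument, where it can be divided out, to the second,
    which it kills. *)
Lemma heyde_split x q n : (0 < n)%N -> q *+ n = 0 -> (exists x', B x = B x' *+ n) ->
  S (B x) q = 1.
Proof.
move=> n0 hn [x' ->]; rewrite heyde_mulrnl -heyde_mulrn hn.
by rewrite S0.
Qed.

(** The origin of the common factor of both distributions: up to a number of modulus 1, [f1] and
    [f2] agree at [x + x]. *)
Lemma heyde_double_unit x : `|f2 (B x)| = 1 ->
  f1 (x + x) = f2 (x + x) / f2 (B x) ^+ 2.
Proof.
move=> hB.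
have -> : f2 (x + x) = f2 (B x) * f2 (A x).
  by rewrite -(cfl_unit cf2) //; congr f2; rewrite /A /B addrACA subrr addr0.
by rewrite -heyde_double; field; rewrite n2.
Qed.

End Heyde.

(** * Bimultiplicative functions on the rationals *)

Lemma mult_exprz (V : zmodType) (C : fieldType) (g : V -> C) :
  (forall x, g x != 0) -> {morph g : x y / x + y >-> x * y} ->
  forall x (k : int), g (x *~ k) = g x ^ k.
Proof.
move=> g0 gD x.
have g00 : g 0 = 1 by apply: (mulfI (g0 0)); rewrite -gD addr0 mulr1.
have gn n : g (x *+ n) = g x ^+ n.
  by elim: n => [|n IH]; rewrite ?mulr0n ?g00 // mulrS gD IH exprS.
case=> n; first by rewrite -pmulrn gn.
rewrite NegzE mulrNz -pmulrn; apply: (mulfI (g0 (x *+ n.+1))).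
by rewrite -gD subrr g00 gn -exprnN mulfV // expf_neq0.
Qed.

Section RatBimult.
Variables (R : realType) (F : rat -> rat -> R[i]).
Hypothesis F0 : forall r s, F r s != 0.
Hypothesis FDl : forall r r' s, F (r + r') s = F r s * F r' s.
Hypothesis FDr : forall r s s', F r (s + s') = F r s * F r s'.
Hypothesis Fgt0 : forall r, 0 < F r r.

(** The additive group of rationals is locally cyclic, so a bimultiplicative function on it is
    determined by its diagonal values [F w w]. *)
Lemma rat_common (r s : rat) : exists (w : rat) (k l : int),
  r = w *~ k /\ s = w *~ l.
Proof.
have dr : (denq r)%:~R != 0 :> rat by rewrite intr_eq0 denq_neq0.
have ds : (denq s)%:~R != 0 :> rat by rewrite intr_eq0 denq_neq0.
exists ((denq r)%:~R * (denq s)%:~R)^-1, (numq r * denq s), (numq s * denq r).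
have mk (x y z : rat) : x != 0 -> y != 0 -> z / x = (x * y)^-1 * (z * y).
  by move=> x0 y0; field; rewrite x0 y0.
split; rewrite -mulrzr intrM.
  by rewrite -[LHS]divq_num_den; exact: mk.
by rewrite -[LHS]divq_num_den [(denq r)%:~R * _]mulrC; exact: mk.
Qed.

Lemma bimult_exprz w v (k l : int) : F (w *~ k) (v *~ l) = F w v ^ (k * l).
Proof.
have -> : F (w *~ k) (v *~ l) = F (w *~ k) v ^ l.
  by apply: (@mult_exprz _ _ (F (w *~ k))) => // x y; exact: FDr.
have -> : F (w *~ k) v = F w v ^ k.
  by apply: (@mult_exprz _ _ (F ^~ v)) => // x y; exact: FDl.
by rewrite exprz_exp.
Qed.

Lemma bimult_gt0 r s : 0 < F r s.
Proof.
have [w [k [l [-> ->]]]] := rat_common r s.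
by rewrite bimult_exprz exprz_gt0.
Qed.

Lemma bimult_expR r s :
  F r s = (expR (ln (complex.Re (F 1 1)) * ratr r * ratr s))%:C.
Proof.
pose G r s := complex.Re (F r s).
have FG p q : F p q = (G p q)%:C.
  by rewrite /G RRe_real // gtr0_real // bimult_gt0.
have G0 p q : 0 < G p q by rewrite -ltcR -FG bimult_gt0.
have GE w k l : G (w *~ k) (w *~ l) = G w w ^ (k * l).
  by apply: complexI; rewrite -FG bimult_exprz FG -rmorphXz ?unitfE ?gt_eqF.
have lnX x (k : int) : 0 < x -> ln (x ^ k) = ln x *~ k :> R.
  move=> x0; case: k => n; first by rewrite -exprnP lnXn // pmulrn.
  rewrite NegzE -exprnN lnV ?posrE ?exprn_gt0 // lnXn // mulrNz.
rewrite FG; congr (_%:C).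
have [w [k [l [er es]]]] := rat_common r s.
(* Now [r], [s] and [1] are all integer multiples of [v], which makes [ln (G r s)] comparable with
   [ln (G 1 1)]. *)
have [v [m [n [ev e1]]]] := rat_common w 1.
have n0 : (n%:~R : rat) != 0.
  by apply/eqP => n0; move: e1; rewrite -mulrzr n0 mulr0 => /eqP; rewrite oner_eq0.
have vE : v = n%:~R^-1 by apply: (mulIf n0); rewrite mulVf // mulrzr -e1.
have n1 : (n%:~R : R) != 0 by rewrite intr_eq0 -(intr_eq0 rat).
have rE : r = (m * k)%:~R / n%:~R by rewrite er ev vE -mulrzA -mulrzr mulrC.
have sE : s = (m * l)%:~R / n%:~R by rewrite es ev vE -mulrzA -mulrzr mulrC.
have L : ln (G r s) = ln (G v v) * ((m * k)%:~R * (m * l)%:~R).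
  by rewrite er es ev -!mulrzA GE lnX // -mulrzr intrM.
have L1 : ln (G 1 1) = ln (G v v) * (n%:~R * n%:~R).
  have -> : G 1 1 = G (v *~ n) (v *~ n) by rewrite -e1.
  by rewrite GE lnX // -mulrzr intrM.
rewrite -[LHS]lnK ?posrE //; congr expR.
rewrite L -/(G 1 1) L1 rE sE !fmorph_div /= !ratr_int.
by field.
Qed.
End RatBimult.

(** * The Heyde equation on the product of the rationals and a torsion group *)

Section GaussianRat.
Variables (R : realType) (f : rat -> R[i]).
Hypothesis cf : charfun_like f.
Hypothesis FD : forall r s s', cocycle f r (s + s') = cocycle f r s * cocycle f r s'.

(** The diagonal [F r r] is the squared modulus of [f r], so the modulus is Gaussian. The Gaussian
    factor has the same cocycle as [f]; dividing it out leaves a character. *)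
Lemma gaussian_rat : exists (sigma : R) (u : rat -> R[i]),
  [/\ 0 <= sigma, forall r, `|u r| = 1, {morph u : r s / r + s >-> r * s} &
      forall r, f r = u r * (expR (- sigma * ratr r ^+ 2))%:C].
Proof.
pose F := cocycle f.
have f0 := cfl_neq0 cf.
have F0 r s : F r s != 0 by exact: cocycle_neq0.
have FDl r r' s : F (r + r') s = F r s * F r' s.
  by rewrite /F ![cocycle f _ s]cocycleC FD.
have Fdiag r : F r r = `|f r| ^+ 2.
  have := FD r r (- r); rewrite subrr (cocycle0 f0 (cfl_0 cf)).
  rewrite {2}/cocycle subrr (cfl_0 cf) (cfl_N cf) -normCK div1r.
  by move=> /esym /divr1_eq.
have Fgt0 r : 0 < F r r by rewrite Fdiag exprn_gt0 // normr_gt0.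
have FE := bimult_expR F0 FDl FD Fgt0.
set c := ln _ in FE.
(* Forced by [F r s] being [expR (c * r * s)]: the squared modulus of [f r] must be both
   [expR (c * r ^+ 2)] and [expR (- 2 * sigma * r ^+ 2)]. *)
pose sigma := - c / 2.
have nf r : `|f r| = (expR (- sigma * ratr r ^+ 2))%:C.
  apply/eqP; rewrite -(@eqrXn2 _ 2) // ?ler0c ?expR_ge0 //.
  rewrite -Fdiag FE -rmorphXn /= -expRM_natl /sigma.
  apply/eqP; congr (_%:C); congr expR; by field.
have sigma_ge0 : 0 <= sigma.
  have := cfl_le1 cf 1; rewrite nf lecR -[leRHS]expR0 ler_expR rmorph1 expr1n mulr1.
  by rewrite oppr_le0.
exists sigma, (fun r => f r / (expR (- sigma * ratr r ^+ 2))%:C); split => //.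
- by move=> r; rewrite normf_div -nf normr_id divff // normr_eq0.
- move=> r s /=.
  rewrite cocycleE // -/F FE -!fmorphV /= -!expRN.
  have e : expR (- (- sigma * ratr (r + s) ^+ 2)) =
    expR (- (- sigma * ratr r ^+ 2)) * expR (- (- sigma * ratr s ^+ 2)) *
    expR (- (c * ratr r * ratr s)) :> R.
    rewrite -!expRD; congr expR; rewrite rmorphD /= /sigma; by field.
  rewrite e !rmorphM /= [expR (- (c * _ * _))]expRN fmorphV /=.
  have : (expR (c * ratr r * ratr s))%:C != 0 :> R[i].
    by rewrite -(rmorph0 (real_complex R)) (inj_eq (@complexI _)) gt_eqF ?expR_gt0.
  by move: (_%:C) (_%:C) (_%:C) => x y z z0; field; rewrite z0.
- move=> r; rewrite divfK //.
  by rewrite -(rmorph0 (real_complex R)) (inj_eq (@complexI _)) gt_eqF ?expR_gt0.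
Qed.
End GaussianRat.

(** * A rational component together with a torsion component *)

Section HeydeProduct.
Variables (R : realType) (H : zmodType) (f1 f2 : rat * H -> R[i]).
Hypotheses (cf1 : charfun_like f1) (cf2 : charfun_like f2).
Variables (a : rat) (bH halfH : H -> H) (n e : nat).
Hypothesis a0 : a != 0.
Hypothesis bHD : {morph bH : x y / x + y}.
Hypothesis halfHD : {morph halfH : x y / x + y}.
Hypothesis halfHK : forall x, halfH x + halfH x = x.
Hypothesis n0 : (0 < n)%N.
Hypothesis nH : forall h : H, h *+ n = 0.
Hypothesis bH_surj : forall y, exists x, bH x = y.
Let AH h := h - bH h.
Hypothesis e0 : (0 < e)%N.
Hypothesis AHe : forall h, iter e AH (iter e AH h) = iter e AH h.

Definition dual_aut (y : rat * H) : rat * H := (a * y.1, bH y.2).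
Let b := dual_aut.

Hypothesis heyde : forall u v,
  f1 (u + v) * f2 (u + b v) = f1 (u - v) * f2 (u - b v).

Let bD : {morph b : x y / x + y}.
Proof. by move=> x y; rewrite /b /dual_aut /= mulrDr bHD. Qed.

Let half (y : rat * H) : rat * H := (y.1 / 2, halfH y.2).

Let halfD : {morph half : x y / x + y}.
Proof. by move=> x y; rewrite /half /= mulrDl halfHD. Qed.

Let halfK x : half x + half x = x.
Proof.
case: x => r h; rewrite /half; congr (_, _) => /=; last exact: halfHK.
by field.
Qed.

Let b_surj y : exists x, b x = y.
Proof.
case: y => r h; have [g <-] := bH_surj h; exists (a^-1 * r, g).
by rewrite /b /dual_aut /= mulrA divff // mul1r.
Qed.

Let A y := y - b y.
Let iterA k r h : iter k A (r, h) = ((1 - a) ^+ k * r, iter k AH h).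
Proof.
elim: k => [|k IH] /=; first by rewrite expr0 mul1r.
by rewrite IH /A /b /dual_aut /=; congr (_, _); rewrite exprS /=; ring.
Qed.

(** On the rationals [1 - a] is zero or invertible. On [H] the iterate [e] of [AH] is idempotent, so
    it kills [h - iter e AH h]. *)
Let A_fitting x : exists x' k, iter k A (x - A x') = 0.
Proof.
(* For [a = 1] the inverse is 0 by convention, and the remaining [r] is killed by [(1 - a) ^+ e]
   because [e] is positive. *)
case: x => r h; exists ((1 - a)^-1 * r, iter e.-1 AH h), e.
have -> : A ((1 - a)^-1 * r, iter e.-1 AH h) =
    ((1 - a) * ((1 - a)^-1 * r), iter e AH h).
  rewrite -[A _]/(iter 1 A _) iterA expr1; congr (_, _).
  by rewrite -[in RHS](prednK e0).
rewrite -[y in iter e A y]/(r - (1 - a) * ((1 - a)^-1 * r), h - iter e AH h) iterA.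
have iterAHD k : {morph (iter k AH) : x y / x + y}.
  by elim: k => [//|k IH] x y /=; rewrite IH /AH bHD opprD addrACA.
rewrite iterAHD (morphDN (iterAHD e)) AHe subrr; congr (_, _).
have [->|a1] := eqVneq (1 - a) 0; first by rewrite expr0n gtn_eqF // mul0r.
by rewrite mulrA divff // mul1r subrr mulr0.
Qed.

Let mult := heyde_mult cf1 cf2 bD halfD halfK heyde b_surj A_fitting.

Lemma heyde_product_unit h : `|f2 (0, h + bH h)| = 1.
Proof.
have e1 : (0, h) + b (0, h) = (0, h + bH h) by rewrite /b /dual_aut /= mulr0; congr (_, _); rewrite addr0.
have := @heyde_torsion _ _ _ _ _ _ cf1 cf2 bD halfD halfK heyde b_surj A_fitting (0, h) n n0.
rewrite e1; apply.
have nE k : (0 : rat, h + bH h) *+ k = (0, (h + bH h) *+ k).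
  elim: k => [//|k IH]; rewrite !mulrS IH; congr (_, _); exact: addr0.
by rewrite nE nH.
Qed.

(** The condition on [x.1] removes the rational component of [x + b x]. It holds for [x.1 = 0]
    whatever [a] is, and for all [x] when [a = -1], so both cases of the theorem use this
    formula. *)
Lemma heyde_product_double x : x.1 + a * x.1 = 0 ->
  f1 (x + x) = f2 (x + x) / f2 (0, x.2 + bH x.2) ^+ 2.
Proof.
move=> x0; have e1 : x + b x = (0, x.2 + bH x.2) by rewrite -x0.
by rewrite -e1; apply: (heyde_double_unit cf1 cf2) => //; rewrite e1; exact: heyde_product_unit.
Qed.

Hypothesis aN1 : a != -1.

Let a1_neq0 : 1 + a != 0.
Proof. by rewrite addrC -[1]opprK subr_eq0. Qed.

(** For [a] other than [-1] every purely rational element is in the image of [1 + b], where the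
    cocycle of [f2] is multiplicative. *)
Let BrE r : (r, 0) = (r / (1 + a), 0) + b (r / (1 + a), 0).
Proof.
rewrite /b /dual_aut /= (morphD0 bHD); congr (_, _) => /=; last by rewrite addr0.
by field.
Qed.

Lemma heyde_product_split2 r h : f2 (r, h) = f2 (r, 0) * f2 (0, h).
Proof.
have -> : (r, h) = (r, 0) + (0, h) by congr (_, _); rewrite ?addr0 ?add0r.
rewrite (cocycleE (cfl_neq0 cf2)) BrE.
rewrite (@heyde_split _ _ _ _ _ _ cf1 cf2 bD halfD halfK heyde b_surj A_fitting _ _ n) ?mulr1 //.
  have nE k : (0 : rat, h) *+ k = (0, h *+ k).
    elim: k => [//|k IH]; rewrite !mulrS IH; congr (_, _); exact: addr0.
  by rewrite nE nH.
exists (r / n%:R / (1 + a), 0); rewrite -!BrE.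
have nE k s : (s : rat, 0 : H) *+ k = (s *+ k, 0).
  elim: k => [//|k IH]; rewrite !mulrS IH; congr (_, _); exact: addr0.
by rewrite nE -[_ *+ n]mulr_natr divfK // pnatr_eq0 -lt0n.
Qed.

Lemma heyde_product_eq1 r h :
  f1 (r + r, h + h) = f2 (r - a * r, h - bH h) / f2 (r + a * r, h + bH h).
Proof.
rewrite -[LHS](mulfK (cfl_neq0 cf2 (r + a * r, h + bH h))).
by have := heyde_double cf1 heyde (r, h) => <-.
Qed.

Lemma heyde_product_split1 r h : f1 (r, h) = f1 (r, 0) * f1 (0, h).
Proof.
have <- : r / 2 + r / 2 = r by field.
rewrite -(halfHK h); move: (r / 2) (halfH h) => {}r {}h.
have -> : (r + r, 0 : H) = (r + r, 0 + 0) by rewrite addr0.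
have -> : (0 : rat, h + h) = (0 + 0, h + h) by rewrite addr0.
rewrite !heyde_product_eq1 (morphD0 bHD) !mulr0 !subr0 !addr0.
rewrite (heyde_product_split2 (r - a * r) (h - _)) (heyde_product_split2 (r + a * r)).
by field; rewrite !cfl_neq0.
Qed.

Lemma heyde_product_gaussian : exists (sigma1 sigma2 : R) (u : rat -> R[i]),
  [/\ 0 <= sigma1 /\ 0 <= sigma2, forall r, `|u r| = 1,
      {morph u : r s / r + s >-> r * s},
      forall r, f1 (r, 0) = u (- a * r) * (expR (- sigma1 * ratr r ^+ 2))%:C &
      forall r, f2 (r, 0) = u r * (expR (- sigma2 * ratr r ^+ 2))%:C].
Proof.
have pD (r s : rat) : (r + s, 0 : H) = (r, 0) + (s, 0) by congr (_, _); rewrite addr0.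
have cg : charfun_like (fun r => f2 (r, 0)).
  split; first exact: (cfl_0 cf2).
  - by move=> p; exact: (cfl_neq0 cf2).
  - by move=> p; rewrite -(cfl_N cf2); congr f2; congr (_, _); rewrite oppr0.
  - by move=> p; exact: (cfl_le1 cf2).
  - by move=> p q hp; rewrite pD; exact: (cfl_unit cf2).
have [r s s'|sigma [u [s0 nu uD fE]]] := gaussian_rat cg.
  have cE p q : cocycle (fun r => f2 (r, 0)) p q = cocycle f2 (p, 0) (q, 0).
    by rewrite /cocycle pD.
  by rewrite !cE pD BrE; exact: mult.
have u0 r : u r != 0 by rewrite -normr_eq0 nu oner_neq0.
(* The exponents combine through [(1 - a) ^+ 2 - (1 + a) ^+ 2 = - 4 * a], which gives the parameter
   [- a * sigma] at the argument [r + r]. *)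
have f1E r : f1 (r, 0) = u (- a * r) * (expR (- (- ratr a * sigma) * ratr r ^+ 2))%:C.
  have <- : r / 2 + r / 2 = r by field.
  move: (r / 2) => {}r.
  have -> : (r + r, 0 : H) = (r + r, 0 + 0) by rewrite addr0.
  rewrite heyde_product_eq1 (morphD0 bHD) subr0 addr0 !fE.
  have -> : r - a * r = - a * (r + r) + (r + a * r) by ring.
  rewrite (uD (- a * (r + r))).
  have -> : ratr (- a * (r + r) + (r + a * r)) = (1 - ratr a) * ratr r :> R.
    rewrite !(rmorphD, rmorphM, rmorphN) /=; ring.
  have -> : ratr (r + a * r) = (1 + ratr a) * ratr r :> R.
    rewrite !(rmorphD, rmorphM, rmorphN) /=; ring.
  have -> : expR (- sigma * ((1 - ratr a) * ratr r) ^+ 2) =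
    expR (- (- ratr a * sigma) * ratr (r + r) ^+ 2) *
    expR (- sigma * ((1 + ratr a) * ratr r) ^+ 2) :> R.
    rewrite -expRD; congr expR; rewrite rmorphD /=; ring.
  rewrite rmorphM /=.
  have : (expR (- sigma * ((1 + ratr a) * ratr r) ^+ 2))%:C != 0 :> R[i].
    by rewrite -(rmorph0 (real_complex R)) (inj_eq (@complexI _)) gt_eqF ?expR_gt0.
  set y := (expR (_ * (_ * _) ^+ 2))%:C => y0; set x := (expR _)%:C.
  by field; rewrite u0 y0.
exists (- ratr a * sigma), sigma, u; split => //; split => //.
(* Nonnegativity of [- a * sigma] comes from the bound on [f1], not from the sign of [a]; for
   positive [a] it forces [sigma = 0]. *)
have := cfl_le1 cf1 (1, 0); rewrite f1E normrM nu mul1r ger0_norm ?ler0c ?expR_ge0 // lecR.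
by rewrite -[leRHS]expR0 ler_expR rmorph1 expr1n mulr1 oppr_le0.
Qed.
End HeydeProduct.

(** * Expectations of bounded functions *)

Section PushProb.
Context d d' (T : measurableType d) (T' : measurableType d') (R : realType).
Variables (mu : probability T R) (f : T -> T').
Hypothesis mf : measurable_fun [set: T] f.

(** The measurability proof is an argument so that the probability structure can be inferred from
    the term itself. *)
Definition push_prob of measurable_fun [set: T] f : set T' -> \bar R :=
  pushforward mu f.

Let M : {measure set T' -> \bar R} :=
  measure_function_pushforward__canonical__measure_function_Measure mu mf.

HB.instance Definition _ := isMeasure.Build _ _ _ (push_prob mf)
  (measure0 M) (measure_ge0 M) (@measure_semi_sigma_additive _ _ _ M).

Let push_setT : push_prob mf setT = 1%E.
Proof. by rewrite /push_prob /pushforward preimage_setT probability_setT. Qed.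

HB.instance Definition _ := Measure_isProbability.Build _ _ _ (push_prob mf) push_setT.
End PushProb.

Section Expectation.
Context d (T : measurableType d) (R : realType).

Definition bounded_meas (h : T -> R) :=
  measurable_fun [set: T] h /\ exists M, forall x, `|h x| <= M.

Lemma bm_cst c : bounded_meas (fun=> c).
Proof. by split; [exact: measurable_cst | exists `|c|]. Qed.

Lemma bm_add g h : bounded_meas g -> bounded_meas h -> bounded_meas (fun x => g x + h x).
Proof.
move=> [mg [M hM]] [mh [N hN]]; split; first exact: measurable_funD.
by exists (M + N) => x; rewrite (le_trans (ler_normD _ _)) // lerD.
Qed.

Lemma bm_mul g h : bounded_meas g -> bounded_meas h -> bounded_meas (fun x => g x * h x).
Proof.
move=> [mg [M hM]] [mh [N hN]]; split; first exact: measurable_funM.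
by exists (M * N) => x; rewrite normrM ler_pM.
Qed.

Lemma bm_opp g : bounded_meas g -> bounded_meas (fun x => - g x).
Proof.
move=> [mg [M hM]]; split; first exact: measurable_funN.
by exists M => x; rewrite normrN.
Qed.

Lemma bm_sub g h : bounded_meas g -> bounded_meas h -> bounded_meas (fun x => g x - h x).
Proof. by move=> bg bh; exact: bm_add (bm_opp bh). Qed.

Lemma bm_exp g n : bounded_meas g -> bounded_meas (fun x => g x ^+ n).
Proof.
move=> bg; elim: n => [|n IH]; first exact: (bm_cst 1).
by under eq_fun do rewrite exprS; exact: bm_mul.
Qed.

Lemma bm_cos t : measurable_fun [set: T] t -> bounded_meas (fun x => cos (t x)).
Proof.
move=> mt; split; last by exists 1 => x; exact: cos_max.
by apply: (measurableT_comp _ mt); apply: continuous_measurable_fun; exact: continuous_cos.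
Qed.

Lemma bm_sin t : measurable_fun [set: T] t -> bounded_meas (fun x => sin (t x)).
Proof.
move=> mt; split; last by exists 1 => x; exact: sin_max.
by apply: (measurableT_comp _ mt); apply: continuous_measurable_fun; exact: continuous_sin.
Qed.

Lemma bm_int (mu : probability T R) h : bounded_meas h -> mu.-integrable setT (EFin \o h).
Proof.
move=> [mh [M hM]]; apply: measurable_bounded_integrable => //.
  by rewrite (le_lt_trans (probability_le1 _ _)) // ltry.
by exists M; split; [exact: num_real | move=> N MN x _; exact: le_trans (hM x) (ltW MN)].
Qed.

Variable mu : probability T R.
Local Notation E h := (Rintegral mu setT h).

Lemma Rint_EFin h : bounded_meas h -> (\int[mu]_x (h x)%:E)%E = (E h)%:E.
Proof. by move=> bh; rewrite /Rintegral fineK // integrable_fin_num //; exact: bm_int. Qed.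

Lemma Rint_cst c : E (fun=> c) = c.
Proof.
rewrite Rintegral_cst //; transitivity (c * fine (1%E : \bar R)); last exact: mulr1.
by congr (_ * fine _); exact: probability_setT.
Qed.

Lemma Rint_add g h : bounded_meas g -> bounded_meas h ->
  E (fun x => g x + h x) = E g + E h.
Proof. by move=> bg bh; apply: RintegralD => //; exact: bm_int. Qed.

Lemma Rint_scale c g : bounded_meas g -> E (fun x => c * g x) = c * E g.
Proof. by move=> bg; apply: RintegralZl => //; exact: bm_int. Qed.

Lemma Rint_sub g h : bounded_meas g -> bounded_meas h ->
  E (fun x => g x - h x) = E g - E h.
Proof. by move=> bg bh; apply: RintegralB => //; exact: bm_int. Qed.

Lemma Rint_eq g h : g =1 h -> E g = E h.
Proof. by move=> gh; apply: eq_Rintegral => x _. Qed.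

Lemma Rint_eq0 h : bounded_meas h -> (forall x, 0 <= h x) -> E h = 0 ->
  {ae mu, forall x, h x = 0}.
Proof.
move=> bh h0 Eh.
have h1 : (\int[mu]_x `|(h x)%:E| = 0)%E.
  rewrite -[RHS]/(0%:E) -Eh -Rint_EFin //.
  by apply: eq_integral => x _; rewrite gee0_abs // lee_fin.
have := (ae_eq_integral_abs mu measurableT _).1 h1.
have mh : measurable_fun setT (EFin \o h) by apply/measurable_EFinP; exact: bh.1.
move=> /(_ mh); apply: filterS => x /(_ I).
by move=> /= e; apply: EFin_inj; exact: e.
Qed.

Lemma Rint_ae g h : bounded_meas g -> bounded_meas h ->
  {ae mu, forall x, g x = h x} -> E g = E h.
Proof.
move=> bg bh gh; rewrite /Rintegral; congr fine.
apply: ae_eq_integral => //.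
  by apply/measurable_EFinP; exact: bg.1.
  by apply/measurable_EFinP; exact: bh.1.
by apply: filterS gh => x /= -> _.
Qed.

End Expectation.

Lemma Rint_push d d' (T : measurableType d) (T' : measurableType d') (R : realType)
  (mu : probability T R) (f : T -> T') (mf : measurable_fun setT f) h :
  bounded_meas h ->
  Rintegral (push_prob mu mf) setT h = Rintegral mu setT (h \o f).
Proof.
move=> bh; rewrite /Rintegral; congr fine.
have bhf : bounded_meas (h \o f).
  case: bh => mh [M hM]; split; first exact: measurableT_comp.
  by exists M => x; exact: hM.
have -> : (\int[push_prob mu mf]_x (h x)%:E = \int[pushforward mu f]_x (h x)%:E)%E by [].
rewrite integral_pushforward //.
- by apply/measurable_EFinP; exact: bh.1.
- by rewrite preimage_setT; exact: bm_int.
Qed.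

Lemma Rint_prod d d' (T : measurableType d) (T' : measurableType d') (R : realType)
  (m1 : probability T R) (m2 : probability T' R) u v :
  bounded_meas u -> bounded_meas v ->
  Rintegral (m1 \x m2)%E setT (fun z => u z.1 * v z.2) =
  Rintegral m1 setT u * Rintegral m2 setT v.
Proof.
move=> bu bv.
have b1 : bounded_meas (fun z : T * T' => u z.1).
  case: bu => mu_ [M hM]; split; first exact: measurableT_comp.
  by exists M => x; exact: hM.
have b2 : bounded_meas (fun z : T * T' => v z.2).
  case: bv => mv_ [M hM]; split; first exact: measurableT_comp.
  by exists M => x; exact: hM.
have bw := bm_mul b1 b2.
rewrite {1}/Rintegral -integral12_prod_meas1; last exact: (bm_int (m1 \x m2)%E bw).
rewrite /fubini_F /=.
under eq_integral => x _.
  rewrite -/(EFin \o _) Rint_EFin; last by apply: bm_mul => //; exact: bm_cst.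
  rewrite Rint_scale // mulrC; over.
by rewrite Rint_EFin ?Rint_scale /= 1?mulrC //; apply: bm_mul => //; exact: bm_cst.
Qed.

(** * Characters of the circle and characteristic functions *)

Section Cis.
Variable R : realType.

Definition cis (t : R) : R[i] := cos (2 * pi * t) +i* sin (2 * pi * t).

Lemma cisD s t : cis (s + t) = cis s * cis t.
Proof.
rewrite /cis mulrDr cosD sinD.
by apply/eqP; rewrite eq_complex /= eqxx /= addrC eqxx.
Qed.

Lemma cis0 : cis 0 = 1.
Proof. by rewrite /cis mulr0 cos0 sin0. Qed.

Lemma cisN t : cis (- t) = (cis t)^*.
Proof. by rewrite /cis mulrN cosN sinN. Qed.

Lemma norm_cis t : `|cis t| = 1.
Proof. by rewrite normc_def /= cos2Dsin2 sqrtr1. Qed.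

Lemma cis_neq0 t : cis t != 0.
Proof. by rewrite -normr_eq0 norm_cis oner_neq0. Qed.

Lemma cisV t : cis (- t) = (cis t)^-1.
Proof. by apply: (mulfI (cis_neq0 t)); rewrite -cisD subrr cis0 divff ?cis_neq0. Qed.

Lemma cis1 : cis 1 = 1.
Proof. by rewrite /cis mulr1 mulr_natl cos2pi sin2pi. Qed.

Lemma cis_int t : t \is a Num.int -> cis t = 1.
Proof.
move=> /intrP[k ->].
by rewrite (mult_exprz cis_neq0 cisD) cis1 exp1rz.
Qed.

(** After reduction to the fractional part [u], the half-angle formula gives [sin (pi * u) = 0],
    whereas the sine is positive strictly between 0 and [pi]. *)
Lemma cis_eq1 t : cis t = 1 -> t \is a Num.int.
Proof.
have h u : 0 <= u < 1 -> cis u = 1 -> u = 0.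
  move=> /andP[u0 u1] [hc _]; apply/eqP/negPn/negP => un0.
  have : 0 < sin (pi * u).
    apply: sin_gt0_pi; rewrite mulr_gt0 ?pi_gt0 //=; last by rewrite lt_neqAle eq_sym un0.
    by rewrite -[ltRHS]mulr1 ltr_pM2l ?pi_gt0.
  move: hc; rewrite -mulrA mulr_natl cos_mulr2n cos2sin2 => /eqP.
  rewrite -subr_eq0 => /eqP e s0.
  have : sin (pi * u) ^+ 2 = 0 by move: e; rewrite mulr2n => e; lra.
  by move=> /eqP; rewrite sqrf_eq0 gt_eqF.
move=> ct; have fl : cis (Defs.frac t) = 1 by rewrite /Defs.frac cisD ct mul1r cis_int // rpredN intr_int.
have := h _ _ fl; rewrite Defs.frac_ge0 Defs.frac_lt1 => /(_ isT) /eqP.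
by rewrite /Defs.frac subr_eq0 => /eqP ->; exact: intr_int.
Qed.

Lemma cis_frac t : cis (Defs.frac t) = cis t.
Proof. by rewrite /Defs.frac cisD [cis (- _)]cis_int ?mulr1 // rpredN intr_int. Qed.

Lemma cis_surj (z : R[i]) : `|z| = 1 -> exists2 t, 0 <= t < 1 & cis t = z.
Proof.
case: z => c s /eqP; rewrite normc_def /= -[1]/(1%:C) (inj_eq (@complexI _)).
move=> /eqP h.
have h1 : c ^+ 2 + s ^+ 2 = 1.
  have := sqr_sqrtr (addr_ge0 (sqr_ge0 c) (sqr_ge0 s)).
  by rewrite h expr1n.
have c1 : -1 <= c <= 1.
  rewrite -ler_norml -(@ler_pXn2r _ 2) ?nnegrE // expr1n real_normK ?num_real //.
  by rewrite -h1 lerDl sqr_ge0.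
pose t := acos c / (2 * pi).
have pi2 : 2 * pi != 0 :> R by rewrite mulf_neq0 // gt_eqF // pi_gt0.
have ct : cos (2 * pi * t) = c.
  by rewrite /t mulrC divfK // acosK // in_itv.
have st : sin (2 * pi * t) ^+ 2 = s ^+ 2 by rewrite sin2cos2 ct -h1 addrC addKr.
have [u hu] : exists u, cis u = c +i* s.
  have [e|e] := eqVneq (sin (2 * pi * t)) s; first by exists t; rewrite /cis ct e.
  exists (- t); rewrite cisN /cis ct /=; congr (_ +i* _).
  move/eqP : st; rewrite eqf_sqr (negPf e) /= => /eqP ->.
  by rewrite opprK.
by exists (Defs.frac u); [rewrite Defs.frac_ge0 Defs.frac_lt1 | rewrite cis_frac].
Qed.
End Cis.

(** * Expectations of circle-valued functions *)

Section CExp.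
Context d (T : measurableType d) (R : realType) (mu : probability T R).
Implicit Types t u : T -> R.

Definition cexp (t : T -> R) : R[i] :=
  Rintegral mu setT (fun x => cos (2 * pi * t x)) +i*
  Rintegral mu setT (fun x => sin (2 * pi * t x)).

Lemma cexp_eq t u : (forall x, cis (t x) = cis (u x)) -> cexp t = cexp u.
Proof.
move=> h; rewrite /cexp; congr (_ +i* _); apply: Rint_eq => x.
  exact: (congr1 (@complex.Re R) (h x)).
exact: (congr1 (@complex.Im R) (h x)).
Qed.

Lemma cexp_cst c : cexp (fun=> c) = cis c.
Proof. by rewrite /cexp !Rint_cst. Qed.

Section Measurable.
Variable t : T -> R.
Hypothesis mt : measurable_fun [set: T] t.

Let m2 : measurable_fun [set: T] (fun x => 2 * pi * t x).
Proof. by apply: measurable_funM => //; exact: measurable_cst. Qed.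

Lemma bm_cos2pi : bounded_meas (fun x => cos (2 * pi * t x)).
Proof. exact: bm_cos. Qed.

Lemma bm_sin2pi : bounded_meas (fun x => sin (2 * pi * t x)).
Proof. exact: bm_sin. Qed.

Let bc := bm_cos2pi.
Let bs := bm_sin2pi.

Lemma cexpN : cexp (fun x => - t x) = (cexp t)^*.
Proof.
rewrite /cexp /=; congr (_ +i* _); first by apply: Rint_eq => x; rewrite mulrN cosN.
rewrite -mulN1r -Rint_scale //; apply: Rint_eq => x.
by rewrite mulrN sinN mulN1r.
Qed.

(** The variance of the complex random variable [cis (t x)]. Its nonnegativity bounds [cexp t], and
    its vanishing is the case of almost sure constancy. *)
Lemma Rint_sqr_dev :
  Rintegral mu setT (fun x => (cos (2 * pi * t x) - complex.Re (cexp t)) ^+ 2 +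
                              (sin (2 * pi * t x) - complex.Im (cexp t)) ^+ 2) =
  1 - (complex.Re (cexp t) ^+ 2 + complex.Im (cexp t) ^+ 2).
Proof.
set C := complex.Re (cexp t); set S := complex.Im (cexp t).
transitivity (Rintegral mu setT (fun x => (1 + (C ^+ 2 + S ^+ 2)) +
   ((- (2 * C)) * cos (2 * pi * t x) + (- (2 * S)) * sin (2 * pi * t x)))).
  apply: Rint_eq => x; move: (cos2Dsin2 (2 * pi * t x)).
  by move: (cos _) (sin _) => a b; nra.
have b1 := bm_mul (bm_cst _ (- (2 * C))) bc.
have b2 := bm_mul (bm_cst _ (- (2 * S))) bs.
rewrite Rint_add ?Rint_cst; [|exact: bm_cst|exact: bm_add].
rewrite Rint_add // !Rint_scale // -/C -/S.
have -> : Rintegral mu setT (fun x => cos (2 * pi * t x)) = C by [].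
have -> : Rintegral mu setT (fun x => sin (2 * pi * t x)) = S by [].
ring.
Qed.

Let bdev : bounded_meas (fun x => (cos (2 * pi * t x) - complex.Re (cexp t)) ^+ 2 +
                              (sin (2 * pi * t x) - complex.Im (cexp t)) ^+ 2).
Proof. by apply: bm_add; apply: bm_exp; apply: bm_sub => //; exact: bm_cst. Qed.

Let dev_ge0 x : 0 <= (cos (2 * pi * t x) - complex.Re (cexp t)) ^+ 2 +
                    (sin (2 * pi * t x) - complex.Im (cexp t)) ^+ 2.
Proof. by rewrite addr_ge0 ?sqr_ge0. Qed.

Lemma cexp_le1 : `|cexp t| <= 1.
Proof.
have := Rintegral_ge0 mu (D := setT) (fun x _ => dev_ge0 x).
rewrite Rint_sqr_dev subr_ge0 => h; rewrite normc_def -[leRHS]/(1%:C) lecR.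
by rewrite -sqrtr1 ler_wsqrtr.
Qed.

Lemma cexp_unit_ae : `|cexp t| = 1 -> {ae mu, forall x, cis (t x) = cexp t}.
Proof.
rewrite normc_def -[1]/(1%:C) => /complexI h.
have h1 : complex.Re (cexp t) ^+ 2 + complex.Im (cexp t) ^+ 2 = 1.
  have := sqr_sqrtr (addr_ge0 (sqr_ge0 (complex.Re (cexp t))) (sqr_ge0 (complex.Im (cexp t)))).
  by rewrite h expr1n.
have := Rint_sqr_dev; rewrite h1 subrr => /(Rint_eq0 bdev dev_ge0).
apply: filterS => x /eqP; rewrite paddr_eq0 ?sqr_ge0 // !sqrf_eq0 !subr_eq0.
by move=> /andP[/eqP hc /eqP hs]; rewrite /cis hc hs; case: (cexp t).
Qed.
End Measurable.

Lemma cexp_unit t u : measurable_fun setT t -> measurable_fun setT u ->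
  `|cexp t| = 1 -> cexp (fun x => t x + u x) = cexp t * cexp u.
Proof.
move=> mt mu_ h; have ae := cexp_unit_ae mt h.
have bc := bm_cos2pi mu_; have bs := bm_sin2pi mu_.
have [bct bst] := (bm_cos2pi (measurable_funD mt mu_), bm_sin2pi (measurable_funD mt mu_)).
case: (cexp t) ae => C S ae.
have bcc (c : R) : bounded_meas (fun x => c * cos (2 * pi * u x)) by apply: bm_mul => //; exact: bm_cst.
have bss (c : R) : bounded_meas (fun x => c * sin (2 * pi * u x)) by apply: bm_mul => //; exact: bm_cst.
apply/eqP; rewrite eq_complex; apply/andP; split; apply/eqP => /=.
- rewrite -!Rint_scale // -Rint_sub //.
  apply: Rint_ae => //; first exact: bm_sub.
  by apply: filterS ae => x [<- <-]; rewrite mulrDr cosD.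
- rewrite -!Rint_scale // -Rint_add //.
  apply: Rint_ae => //; first exact: bm_add.
  by apply: filterS ae => x [<- <-]; rewrite mulrDr sinD addrC.
Qed.
End CExp.

Lemma cexp_shift d (T : measurableType d) (R : realType) (mu : probability T R)
  (t : T -> R) c : measurable_fun setT t -> cexp mu (fun x => t x + c) = cexp mu t * cis c.
Proof.
move=> mt; rewrite -(cexp_cst mu) mulrC -cexp_unit ?cexp_cst ?norm_cis //.
by apply: cexp_eq => x; rewrite addrC.
Qed.

Lemma cexp_push d d' (T : measurableType d) (T' : measurableType d') (R : realType)
  (mu : probability T R) (f : T -> T') (mf : measurable_fun setT f) (t : T' -> R) :
  measurable_fun setT t -> cexp (push_prob mu mf) t = cexp mu (t \o f).
Proof.
by move=> mt; rewrite /cexp !Rint_push //; [exact: bm_sin2pi | exact: bm_cos2pi].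
Qed.

Lemma cexp_prod d d' (T : measurableType d) (T' : measurableType d') (R : realType)
  (m1 : probability T R) (m2 : probability T' R) (t : T -> R) (u : T' -> R) :
  measurable_fun setT t -> measurable_fun setT u ->
  cexp (m1 \x m2)%E (fun z => t z.1 + u z.2) = cexp m1 t * cexp m2 u.
Proof.
move=> mt mu_.
have [bc bs] := (bm_cos2pi mt, bm_sin2pi mt).
have [bc' bs'] := (bm_cos2pi mu_, bm_sin2pi mu_).
have l (h : T -> R) : bounded_meas h -> bounded_meas (fun z : T * T' => h z.1).
  by move=> [mh [M hM]]; split; [exact: measurableT_comp | exists M => x].
have r (h : T' -> R) : bounded_meas h -> bounded_meas (fun z : T * T' => h z.2).
  by move=> [mh [M hM]]; split; [exact: measurableT_comp | exists M => x].
apply/eqP; rewrite eq_complex; apply/andP; split; apply/eqP => /=.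
- rewrite -!Rint_prod // -Rint_sub; [|by apply: bm_mul; [exact: (l _ bc)|exact: (r _ bc')]
    |by apply: bm_mul; [exact: (l _ bs)|exact: (r _ bs')]].
  by apply: Rint_eq => z; rewrite mulrDr cosD.
- rewrite -!Rint_prod // -Rint_add; [|by apply: bm_mul; [exact: (l _ bc)|exact: (r _ bs')]
    |by apply: bm_mul; [exact: (l _ bs)|exact: (r _ bc')]].
  by apply: Rint_eq => z; rewrite mulrDr sinD addrC.
Qed.

(** * Uniqueness of measures from an algebra of bounded functions *)

Section Step.
Variable R : realType.
Implicit Types s u x : R.

(** The quotient of [1 - s ^+ n] by [1 - s] is a geometric sum of [n] terms, each at least
    [s ^+ n]. *)
Lemma natmul_expr_bound s n : 0 <= s <= 1 -> n%:R * s ^+ n * (1 - s) <= 1 - s ^+ n.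
Proof.
move=> /andP[s0 s1]; elim: n => [|n IH]; first by rewrite !mul0r expr0 subrr.
have h1 : 0 <= s ^+ n <= 1 by rewrite exprn_ge0 // exprn_ile1.
move: h1 IH; rewrite !exprS -natr1; move: (s ^+ n) (n%:R) => p m /andP[p0 p1] IH.
have : s * (m * p * (1 - s)) <= s * (1 - p) by exact: ler_wpM2l.
have : 0 <= (1 - s * p) * (1 - s) by rewrite mulr_ge0 ?subr_ge0 ?mulr_ile1.
by nra.
Qed.

Lemma cvg_natmul_expr q : 0 <= q < 1 -> (fun n => n%:R * q ^+ n : R) @ \oo --> 0.
Proof.
(* With [q = s * s], one factor [s ^+ n] absorbs [n] and the other still tends to 0. *)
move=> /andP[q0 q1]; pose s := Num.sqrt q.
have s0 : 0 <= s by exact: sqrtr_ge0.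
have s1 : s < 1 by rewrite -sqrtr1 ltr_sqrt.
have qE : q = s * s by rewrite -expr2 sqr_sqrtr.
apply: (@squeeze_cvgr _ _ _ _ (fun=> 0) (fun n => (1 - s)^-1 * s ^+ n)).
- apply: nearW => n; rewrite mulr_ge0 ?exprn_ge0 //=.
  rewrite qE exprMn mulrA ler_wpM2r ?exprn_ge0 //.
  rewrite -[leRHS]mul1r ler_pdivlMr ?subr_gt0 //.
  have s01 : 0 <= s <= 1 by rewrite s0 ltW.
  by rewrite (le_trans (natmul_expr_bound n s01)) // lerBlDr lerDl exprn_ge0.
- exact: cvg_cst.
- rewrite -[0](mulr0 (1 - s)^-1); apply: cvgM; first exact: cvg_cst.
  by apply: cvg_expr; rewrite ger0_norm.
Qed.

Lemma bernoulli_lower x N : 0 <= x <= 1 -> 1 - N%:R * x <= (1 - x) ^+ N.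
Proof.
move=> /andP[x0 x1]; elim: N => [|N IH]; first by rewrite mul0r subr0 expr0.
rewrite exprS -natr1.
have := ler_wpM2l (_ : 0 <= 1 - x) IH; rewrite subr_ge0 => /(_ x1).
have : 0 <= N%:R * (x * x) by rewrite !mulr_ge0.
by move: (_ ^+ N) (N%:R) => p m; nra.
Qed.

Lemma bernoulli_upper x N : 0 <= x <= 1 -> (1 - x) ^+ N * (1 + N%:R * x) <= 1.
Proof.
move=> /andP[x0 x1]; elim: N => [|N IH]; first by rewrite mul0r addr0 expr0 mulr1.
apply: le_trans IH; rewrite exprSr -mulrA; apply: ler_wpM2l.
  by rewrite exprn_ge0 // subr_ge0.
rewrite -natr1; have : 0 <= N%:R * (x * x) by rewrite !mulr_ge0.
have : 0 <= x * x by rewrite mulr_ge0.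
by move: (N%:R) => m; nra.
Qed.

(** Polynomials of the kind used in the Brosowski-Deutsch proof of the Stone-Weierstrass theorem,
    tending on [0, 1] to the indicator of [x < 2^-1]. *)
Definition step_poly n (x : R) := (1 - x ^+ n) ^+ (n * 2 ^ n).

Lemma step_poly_itv n x : 0 <= x <= 1 -> 0 <= step_poly n x <= 1.
Proof.
move=> /andP[x0 x1]; have h : 0 <= x ^+ n <= 1 by rewrite exprn_ge0 // exprn_ile1.
by rewrite exprn_ge0 ?exprn_ile1 //=; lra.
Qed.

(* The factor [n] in the exponent makes the limit vanish at the threshold too. *)
Lemma cvg_step_poly x : 0 <= x <= 1 -> step_poly ^~ x @ \oo --> ((x < 2^-1)%R%:R : R).
Proof.
move=> x01; have /andP[x0 x1] := x01.
have xn n : 0 <= x ^+ n <= 1 by rewrite exprn_ge0 // exprn_ile1.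
(* Below the threshold Bernoulli gives the lower bound [1 - n * (2 * x) ^+ n]; from the threshold
   on, [bernoulli_upper] gives the upper bound [1 / (n + 1)]. *)
case: ltP => hx.
- have q : 0 <= 2 * x < 1.
    by rewrite mulr_ge0 //= mulrC -ltr_pdivlMr // mul1r.
  apply: (@squeeze_cvgr _ _ _ _ (fun n => 1 - n%:R * (2 * x) ^+ n) (fun=> 1)).
  + apply: nearW => n; rewrite (andP (step_poly_itv n x01)).2 andbT.
    apply: le_trans (bernoulli_lower _ (xn n)).
    by rewrite natrM natrX exprMn mulrA.
  + rewrite -[z in _ --> z]subr0; apply: cvgB; first exact: cvg_cst.
    exact: cvg_natmul_expr.
  + exact: cvg_cst.
- apply: (@squeeze_cvgr _ _ _ _ (fun=> 0) (@harmonic R)).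
  + apply: nearW => n; rewrite (andP (step_poly_itv n x01)).1 /=.
    rewrite -[leRHS]mul1r ler_pdivlMr ?ltr0Sn //.
    apply: le_trans (bernoulli_upper (n * 2 ^ n) (xn n)).
    apply: ler_wpM2l; first by rewrite (andP (step_poly_itv n x01)).1.
    rewrite -natr1 addrC lerD2l natrM natrX -mulrA -exprMn.
    rewrite -[leLHS]mulr1; apply: ler_wpM2l => //; apply: exprn_ege1.
    by rewrite mulrC -ler_pdivrMr // mul1r.
  + exact: cvg_cst.
  + exact: cvg_harmonic.
Qed.
End Step.

(** * Probabilities that agree on an algebra of bounded functions *)

Section AlgebraUnique.
Context d (T : measurableType d) (R : realType) (mu nu : probability T R).
Variable K : (T -> R) -> Prop.
Hypothesis K_bm : forall h, K h -> bounded_meas h.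
Hypothesis K_cst : forall c, K (fun=> c).
Hypothesis K_add : forall g h, K g -> K h -> K (fun x => g x + h x).
Hypothesis K_mul : forall g h, K g -> K h -> K (fun x => g x * h x).
Hypothesis K_eq : forall h, K h -> Rintegral mu setT h = Rintegral nu setT h.

Let K_exp g n : K g -> K (fun x => g x ^+ n).
Proof.
move=> Kg; elim: n => [|n IH]; first exact: (K_cst 1).
have -> : (fun x => g x ^+ n.+1) = (fun x => g x * g x ^+ n).
  by apply/funext => x; rewrite exprS.
exact: K_mul.
Qed.

(** These sets form a pi-system, since approximations can be multiplied, and [mu] and [nu] agree on
    them by dominated convergence. *)
Definition approximable (A : set T) := exists phi : nat -> T -> R,
  [/\ forall n, K (phi n), forall n x, 0 <= phi n x <= 1 &
      forall x, phi ^~ x @ \oo --> (\1_A x : R)].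

Lemma approximableI : setI_closed approximable.
Proof.
move=> A B [phi [Kphi phi01 phiA]] [psi [Kpsi psi01 psiB]].
exists (fun n x => phi n x * psi n x); split.
- by move=> n; exact: K_mul.
- move=> n x; have /andP[a b] := phi01 n x; have /andP[a' b'] := psi01 n x.
  by rewrite mulr_ge0 //= mulr_ile1.
- by move=> x; rewrite indicI; apply: cvgM.
Qed.

Lemma approximable_gt h c : K h -> approximable [set x | c < h x].
Proof.
move=> Kh; have [_ [M hM]] := K_bm Kh.
(* [u] is an affine rescaling of [h] into [0, 1] for which [c < h x] becomes [u x < 2^-1]; the
   summand 1 keeps [D] positive. *)
pose D := 2 * (`|M| + `|c| + 1).
have D0 : 0 < D by rewrite mulr_gt0 // ltr_wpDl // addr_ge0.
pose u x := 2^-1 + (c - h x) / D.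
have u01 x : 0 <= u x <= 1.
  have : `|(c - h x) / D| <= 2^-1.
    rewrite normrM [`|D^-1|]gtr0_norm ?invr_gt0 // ler_pdivrMr // mulKf //.
    apply: le_trans (ler_normB _ _) _.
    have := hM x; have := ler_norm M.
    by move: `|h x| `|M| `|c| => p q r; lra.
  rewrite ler_norml /u => /andP[]; lra.
have Ku : K u.
  have -> : u = (fun x => (2^-1 + c / D) + (- D^-1) * h x).
    by apply/funext => x; rewrite /u; ring.
  by apply: K_add => //; apply: K_mul.
exists (fun n x => step_poly n (u x)); split.
- move=> n; apply: K_exp.
  have -> : (fun x => 1 - u x ^+ n) = (fun x => 1 + (-1) * u x ^+ n).
    by apply/funext => x; rewrite mulN1r.
  by apply: K_add => //; apply: K_mul => //; exact: K_exp.
- by move=> n x; exact: step_poly_itv.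
- move=> x; have := cvg_step_poly (u01 x).
  suff -> : \1_[set x0 | c < h x0] x = (u x < 2^-1)%R%:R :> R by [].
  rewrite indicE; congr (_%:R); congr nat_of_bool.
  rewrite /u gtrDl pmulr_llt0 ?invr_gt0 // subr_lt0.
  by apply/idP/idP; rewrite inE.
Qed.

Lemma approximable_measurable A : approximable A -> measurable A.
Proof.
move=> [phi [Kphi _ phiA]]; apply/(@measurable_indicP _ _ R).
by apply: (measurable_fun_cvg (h := phi)) => // n; exact: (K_bm (Kphi n)).1.
Qed.

Lemma approximable_limit (m : probability T R) A phi :
  (forall n, K (phi n)) -> (forall n x, 0 <= phi n x <= 1) ->
  (forall x, phi ^~ x @ \oo --> (\1_A x : R)) -> measurable A ->
  (fun n => (Rintegral m setT (phi n))%:E) @ \oo --> m A.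
Proof.
move=> Kphi phi01 phiA mA.
have mE : m A = (\int[m]_x (\1_A x)%:E)%E by rewrite integral_indic // setIT.
rewrite mE.
have -> : (fun n => (Rintegral m setT (phi n))%:E) = (fun n => \int[m]_x (phi n x)%:E)%E.
  by apply/funext => n; rewrite Rint_EFin //; exact: K_bm.
have [] // := @dominated_convergence _ _ _ m setT measurableT
  (fun n x => (phi n x)%:E) (fun x => (\1_A x)%:E) (fun=> 1%E).
- by move=> n; apply/measurable_EFinP; exact: (K_bm (Kphi n)).1.
- by apply/measurable_EFinP; exact: measurable_indic.
- by apply: aeW => x _; apply: cvg_EFin; [exact: nearW | exact: phiA].
- by have := bm_int m (bm_cst _ 1).
- apply: aeW => x n _; have /andP[a b] := phi01 n x.
  by rewrite lee_fin ger0_norm.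
Qed.

Lemma algebra_unique A :
  <<s [set B | exists h c, K h /\ B = [set x | c < h x]] >> A -> mu A = nu A.
Proof.
move=> sA; apply: (g_sigma_algebra_measure_unique approximable _ (fun=> setT)).
- by move=> B; exact: approximable_measurable.
- move=> _; exists (fun _ _ => 1); split => // [n x|x].
    by rewrite ler01 lexx.
  by rewrite indicT; exact: cvg_cst.
- exact: bigcup_const.
- exact: approximableI.
- move=> B PB; have mB := approximable_measurable PB.
  case: PB => phi [Kphi phi01 phiB].
  have h1 := approximable_limit (m := mu) Kphi phi01 phiB mB.
  have h2 := approximable_limit (m := nu) Kphi phi01 phiB mB.
  have e : (fun n => (Rintegral mu setT (phi n))%:E) = (fun n => (Rintegral nu setT (phi n))%:E).
    by apply/funext => n; rewrite K_eq.
  by rewrite e in h1; exact: (cvg_unique _ h1 h2).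
- by move=> _; rewrite (le_lt_trans (probability_le1 _ _)) // ltry.
- apply: sub_sigma_algebra2 sA => B [h [c [Kh ->]]]; exact: approximable_gt.
Qed.
End AlgebraUnique.

(** * Duality of finite abelian groups *)

Section Separation.
Import FinRing.Theory fingroup cyclic cyclotomic algC classfun character.

Lemma finZmod_mulrn_card (G : finZmodType) (g : G) : g *+ #|G| = 0.
Proof.
have := @expg_cardG G [set: G]%G g (finset.in_setT g).
by rewrite cardsT zmodXgE.
Qed.

(** Irreducible complex characters of an abelian group are linear and their kernels meet trivially.
    Their values are roots of unity of order dividing [q.+2]; [chi] records the exponents relative
    to a primitive root. *)
Lemma finZmod_char_separates (G : finZmodType) (q : nat) (g : G) :
  (#|G| %| q.+2)%N -> g != 0 ->
  exists2 chi : G -> 'I_q.+2, {morph chi : x y / x + y >-> x + y} & chi g != 0.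
Proof.
move=> dG g0.
have abG : abelian [set: G]%G by exact: zmod_abelian.
have lin i : 'chi[[set: G]%G]_i \is a linear_char by exact/char_abelianP.
have [i gi] : exists i, g \notin cfker 'chi[[set: G]%G]_i.
  apply/existsP; rewrite -negb_forall; apply: contra g0 => /forallP h.
  have : g \in [1 G]%g.
    by rewrite -(TI_cfker_irr [set: G]%G); apply/finset.bigcapP => i _; exact: h.
  by rewrite finset.in_set1.
have [z pz] := C_prim_root_exists (ltn0Sn q.+1).
have root x : 'chi[[set: G]%G]_i x ^+ q.+2 = 1.
  have [k ->] := dvdnP dG.
  rewrite mulnC exprM -lin_charX ?finset.in_setT // -cardsT expg_cardG ?finset.in_setT //.
  by rewrite lin_char1 // expr1n.
pose chi x := sval (prim_rootP pz (root x)).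
have chiE x : 'chi[[set: G]%G]_i x = z ^+ chi x by exact: svalP (prim_rootP pz (root x)).
exists chi.
- move=> x y; apply/val_inj => /=.
  have /eqP : z ^+ chi (x + y) = z ^+ (chi x + chi y)%N.
    by rewrite exprD -!chiE -lin_charM ?finset.in_setT.
  by rewrite (eq_prim_root_expr pz) => /eqP; rewrite modn_small.
- apply: contra gi => /eqP c0; rewrite cfkerEirr finset.in_set /=.
  by rewrite chiE c0 expr0 lin_char1.
Qed.
End Separation.

Section Dual.
Variables (G : finZmodType) (q : nat).

Definition additive_pred : {pred {ffun G -> 'I_q.+2}} :=
  [pred chi : {ffun G -> 'I_q.+2} | [forall g, forall h, chi (g + h) == chi g + chi h]].

Fact additive_pred_zmod : zmod_closed additive_pred.
Proof.
split.
  by apply/forallP => g; apply/forallP => h; rewrite !ffunE addr0.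
move=> x y /forallP hx /forallP hy; apply/forallP => g; apply/forallP => h.
rewrite !ffunE (eqP (forallP (hx g) h)) (eqP (forallP (hy g) h)).
by rewrite opprD addrACA.
Qed.

HB.instance Definition _ := GRing.isZmodClosed.Build _ additive_pred additive_pred_zmod.

(* The dual of [G] when [#|G|] divides [q.+2], the value [k] standing for the
   angle [k / q.+2]. *)
Record dual := Dual { dualv :> {ffun G -> 'I_q.+2}; _ : dualv \in additive_pred }.

HB.instance Definition _ := [isSub for dualv].
HB.instance Definition _ := [Countable of dual by <:].
HB.instance Definition _ := [Finite of dual by <:].
HB.instance Definition _ := [SubChoice_isSubZmodule of dual by <:].

Lemma dualM (chi : dual) : {morph chi : g h / g + h >-> g + h}.
Proof. by case: chi => chi /= /forallP h g1 g2; exact/eqP/(forallP (h g1)). Qed.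

Lemma dualD (chi psi : dual) g : (chi + psi) g = chi g + psi g.
Proof. by rewrite [chi + psi]/(_ + _) /= ffunE. Qed.

Definition mk_dual (f : G -> 'I_q.+2) (fD : {morph f : x y / x + y >-> x + y}) : dual.
Proof.
exists [ffun g => f g]; apply/forallP => g; apply/forallP => h.
by rewrite !ffunE fD.
Defined.

Lemma mk_dualE f fD g : @mk_dual f fD g = f g.
Proof. by rewrite /= ffunE. Qed.

Lemma dual_eq (chi psi : dual) : (forall g, chi g = psi g) -> chi = psi.
Proof. by move=> h; apply/val_inj/ffunP. Qed.

Lemma dual0l g : (0 : dual) g = 0.
Proof. by rewrite [LHS]ffunE. Qed.

Lemma dual0r (chi : dual) : chi 0 = 0.
Proof. by apply: (addrI (chi 0)); rewrite -dualM !addr0. Qed.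

Lemma dual_mulrn_card (chi : dual) : chi *+ #|G| = 0.
Proof.
apply: dual_eq => g.
have e n : (chi *+ n) g = chi (g *+ n).
  elim: n => [|n IH]; last by rewrite !mulrS dualD dualM IH.
  by rewrite !mulr0n dual0l dual0r.
by rewrite e finZmod_mulrn_card dual0l dual0r.
Qed.

Section Comp.
Variable f : G -> G.
Hypothesis fD : {morph f : x y / x + y}.

Let cD (chi : dual) : {morph (chi \o f) : x y / x + y >-> x + y}.
Proof. by move=> x y /=; rewrite fD dualM. Qed.

Definition dual_comp (chi : dual) : dual := mk_dual (cD chi).

Lemma dual_compE chi g : dual_comp chi g = chi (f g).
Proof. by rewrite mk_dualE. Qed.

Lemma dual_compD : {morph dual_comp : x y / x + y}.
Proof. by move=> x y; apply: dual_eq => g; rewrite dualD !dual_compE dualD. Qed.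
End Comp.
End Dual.

(** * Characters of the product group and their behaviour under its operations *)

Section Angles.
Variables (R : realType) (G : finZmodType) (q : nat).

Definition zang (k : 'I_q.+2) : R := (k : nat)%:R / q.+2%:R.

Lemma cis_zangD (k l : 'I_q.+2) : cis (zang (k + l)) = cis (zang k) * cis (zang l).
Proof.
have e : zang k + zang l = zang (k + l) + ((k + l) %/ q.+2)%N%:R.
  rewrite /zang -mulrDl -natrD {1}(divn_eq (k + l) q.+2) natrD natrM mulrDl mulfK ?pnatr_eq0 //.
  by rewrite addrC.
by rewrite -cisD e cisD [cis _%:R]cis_int ?mulr1 // natr_int.
Qed.

Lemma cis_zang_inj : injective (fun k : 'I_q.+2 => cis (zang k)).
Proof.
move=> k l h; have := cis_zangD (k - l) l; rewrite subrK h -{1}[cis (zang l)]mul1r.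
move=> /(mulIf (cis_neq0 _)) /esym /cis_eq1.
have lt (j : 'I_q.+2) : 0 <= zang j < 1.
  by rewrite /zang divr_ge0 //= ltr_pdivrMr ?ltr0Sn // mul1r ltr_nat ltn_ord.
have /andP[a b] := lt (k - l); move=> /intrP[m em].
have m0 : m = 0.
  by move: a b; rewrite em ler0z -[1]/(1%:~R) ltr_int; case: m {em} => [[|n]|n].
move: em; rewrite m0 /zang => /eqP; rewrite mulf_eq0 invr_eq0 !pnatr_eq0 orbF => /eqP e.
by apply/eqP; rewrite -subr_eq0; apply/eqP/val_inj.
Qed.

Local Notation Y := (rat * dual G q)%type.

Definition angle (y : Y) (x : X R G) : R := X_angle y.1 (fun g => zang (y.2 g)) x.

Lemma is_charG_dual (chi : dual G q) : is_charG (fun g => zang (chi g)).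
Proof.
move=> g h; apply: cis_eq1; rewrite !cisD !cisV dualM cis_zangD.
by rewrite [cis (zang (chi g)) * _]mulrC mulfK ?cis_neq0 // divff ?cis_neq0.
Qed.

Lemma cis_solD (x : solenoid R) r s : cis (solv x (r + s)) = cis (solv x r) * cis (solv x s).
Proof.
have [_ h] := Defs.solP x.
by rewrite -cisD -[RHS]mul1r -(cis_int (h r s)) -cisD; congr cis; ring.
Qed.

Lemma cis_angle y x : cis (angle y x) = cis (solv x.1 y.1) * cis (zang (y.2 x.2)).
Proof. by rewrite -cisD. Qed.

Lemma cis_angleD y y' x : cis (angle (y + y') x) = cis (angle y x) * cis (angle y' x).
Proof. by rewrite !cis_angle /= cis_solD dualD cis_zangD; ring. Qed.

Lemma cis_angle_add y x x' : cis (angle y (X_add x x')) = cis (angle y x) * cis (angle y x').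
Proof.
by rewrite !cis_angle /= cis_frac cisD dualM cis_zangD; ring.
Qed.

Lemma cis_angle0 x : cis (angle 0 x) = 1.
Proof. by apply: (mulfI (cis_neq0 (angle 0 x))); rewrite -cis_angleD addr0 mulr1. Qed.

Lemma cis_angleN y x : cis (angle (- y) x) = cis (- angle y x).
Proof.
by rewrite cisV; apply: (mulfI (cis_neq0 (angle y x)));
  rewrite -cis_angleD subrr cis_angle0 divff ?cis_neq0.
Qed.

Lemma cis_angle_opp y x : cis (angle y (X_opp x)) = cis (- angle y x).
Proof.
rewrite -cis_angleN !cis_angle /=; congr (_ * cis (zang _)).
apply: (addrI (y.2 x.2)); rewrite -dualM subrr dual0r.
by rewrite -(dual0l q (x.2 : G)) -(subrr y.2) dualD.
Qed.

Lemma cis_angle_aut a alphaG (aD : {morph alphaG : x y / x + y}) y x :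
  cis (angle y (X_aut a alphaG x)) = cis (angle (a * y.1, dual_comp aD y.2) x).
Proof. by rewrite !cis_angle /= dual_compE. Qed.
End Angles.

(** * Uniqueness of measures on the product group from characteristic functions *)

Section Measurability.
Variables (R : realType) (G : finZmodType).

Lemma measurable_discr d (T : measurableType d) (h : T -> discr G) :
  (forall g : G, measurable (h @^-1` [set (g : discr G)])) -> measurable_fun setT h.
Proof.
move=> mh _ D _; rewrite setTI.
have -> : h @^-1` D = \bigcup_(g in (D : set G)) (h @^-1` [set (g : discr G)]).
  apply/seteqP; split=> [x /= Dx|x [g Dg /= ->] //].
  by exists (h x).
by apply: fin_bigcup_measurable => //; exact: finite_finset.
Qed.

Lemma measurable_from_discr d (T : measurableType d) (h : discr G -> T) :
  measurable_fun setT h.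
Proof. by []. Qed.

Lemma measurable_to_sol d (T : measurableType d) (h : T -> Sol R) :
  (forall r, measurable_fun setT (fun x => solv (h x) r)) -> measurable_fun setT h.
Proof.
move=> mh; apply: (@measurability _ _ _ _ setT h (@sol_gen R) erefl).
move=> _ [_ [r [B mB ->]] <-].
exact: mh.
Qed.

Lemma measurable_solv r : measurable_fun setT (fun x : Sol R => solv x r).
Proof.
move=> _ B mB; rewrite setTI; apply: sub_sigma_algebra.
by exists r, B.
Qed.

Lemma measurable_frac : measurable_fun setT (@Defs.frac R).
Proof.
apply: measurable_funB => //; apply: nondecreasing_measurable => //.
by move=> x y xy; rewrite ler_int; exact: Num.Theory.le_floor.
Qed.

Lemma measurable_angle q (y : rat * dual G q) :
  measurable_fun setT (@angle R G q y).
Proof.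
apply: measurable_funD.
  exact: (measurableT_comp (measurable_solv y.1) measurable_fst).
exact: (measurableT_comp
  (@measurable_from_discr _ _ (fun g : discr G => zang R (y.2 g) : R)) measurable_snd).
Qed.

Lemma measurable_pair_discr d (T : measurableType d) (k : discr G -> discr G -> discr G)
    (f g : T -> discr G) :
  measurable_fun setT f -> measurable_fun setT g -> measurable_fun setT (fun x => k (f x) (g x)).
Proof.
move=> mf mg; apply: measurable_discr => c.
have -> : (fun x => k (f x) (g x)) @^-1` [set c] =
  \bigcup_(ab in [set ab : G * G | k ab.1 ab.2 = c])
    (f @^-1` [set (ab.1 : discr G)] `&` g @^-1` [set (ab.2 : discr G)]).
  apply/seteqP; split=> [x /= kx|x [[a b] /= <- [-> ->]] //].
  by exists (f x : G, g x : G).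
apply: fin_bigcup_measurable; first exact: finite_finset.
by move=> ab _; apply: measurableI; rewrite -[z in measurable z]setTI; [exact: mf | exact: mg].
Qed.

Lemma measurable_X_add d (T : measurableType d) (f g : T -> X R G) :
  measurable_fun setT f -> measurable_fun setT g ->
  measurable_fun setT (fun x => X_add (f x) (g x)).
Proof.
move=> /measurable_fun_pairP[f1 f2] /measurable_fun_pairP[g1 g2].
apply: measurable_fun_pair.
  apply: measurable_to_sol => r /=; apply: (measurableT_comp measurable_frac).
  by apply: measurable_funD; apply: (measurableT_comp (measurable_solv r)).
exact: (@measurable_pair_discr _ _ (fun a b : G => a + b)).
Qed.

Lemma measurable_X_opp d (T : measurableType d) (f : T -> X R G) :
  measurable_fun setT f -> measurable_fun setT (fun x => X_opp (f x)).
Proof.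
move=> /measurable_fun_pairP[f1 f2]; apply: measurable_fun_pair.
  apply: measurable_to_sol => r /=; exact: (measurableT_comp (measurable_solv (- r))).
exact: (measurableT_comp (@measurable_from_discr _ _ (fun g : discr G => - (g : G) : discr G)) f2).
Qed.

Lemma measurable_X_aut d (T : measurableType d) a alphaG (f : T -> X R G) :
  measurable_fun setT f -> measurable_fun setT (fun x => X_aut a alphaG (f x)).
Proof.
move=> /measurable_fun_pairP[f1 f2]; apply: measurable_fun_pair.
  apply: measurable_to_sol => r /=; exact: (measurableT_comp (measurable_solv (a * r))).
exact: (measurableT_comp (@measurable_from_discr _ _ (fun g : discr G => alphaG g : discr G)) f2).
Qed.
End Measurability.

(** * Trigonometric polynomials on the product group *)

Section Trig.
Variables (R : realType) (G : finZmodType) (q : nat).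
Local Notation Y := (rat * dual G q)%type.
Local Notation XR := (X R G).

Inductive trig : (XR -> R) -> Prop :=
| trig_cst c : trig (fun=> c)
| trig_cos y : trig (fun x => cos (2 * pi * @angle R G q y x))
| trig_sin y : trig (fun x => sin (2 * pi * @angle R G q y x))
| trig_add g h : trig g -> trig h -> trig (fun x => g x + h x)
| trig_mul g h : trig g -> trig h -> trig (fun x => g x * h x).

Lemma trig_bm h : trig h -> bounded_meas h.
Proof.
elim=> {h} [c|y|y|g h _ bg _ bh|g h _ bg _ bh].
- exact: bm_cst.
- by apply: bm_cos2pi; exact: measurable_angle.
- by apply: bm_sin2pi; exact: measurable_angle.
- exact: bm_add.
- exact: bm_mul.
Qed.

Lemma trig_shift y t : trig (fun x => cos (2 * pi * (@angle R G q y x - t))).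
Proof.
have -> : (fun x => cos (2 * pi * (@angle R G q y x - t))) =
   (fun x => cos (2 * pi * t) * cos (2 * pi * @angle R G q y x) +
             sin (2 * pi * t) * sin (2 * pi * @angle R G q y x)).
  by apply/funext => x; rewrite mulrBr cosB; ring.
by apply: trig_add; apply: trig_mul; [exact: trig_cst | exact: trig_cos
  | exact: trig_cst | exact: trig_sin].
Qed.

Variables mu nu : probability XR R.
Hypothesis mu_nu : forall y : Y, cexp mu (angle y) = cexp nu (angle y).

Let E (m : probability XR R) h := Rintegral m setT h.

(** Equality of expectations against every character, rather than of [k] alone: this form is stable
    under multiplication by a character. *)
Let agree (k : XR -> R) := bounded_meas k /\ forall y : Y,
  E mu (fun x => k x * cos (2 * pi * angle y x)) = E nu (fun x => k x * cos (2 * pi * angle y x)) /\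
  E mu (fun x => k x * sin (2 * pi * angle y x)) = E nu (fun x => k x * sin (2 * pi * angle y x)).

Let bc y := bm_cos2pi (@measurable_angle R G q y).
Let bs y := bm_sin2pi (@measurable_angle R G q y).

Let cosD (y y' : Y) (x : XR) : cos (2 * pi * angle (y + y') x) =
  cos (2 * pi * angle y x) * cos (2 * pi * angle y' x) -
  sin (2 * pi * angle y x) * sin (2 * pi * angle y' x) :> R.
Proof. by have := congr1 (@complex.Re R) (cis_angleD y y' x); rewrite /cis /=. Qed.

Let sinD (y y' : Y) (x : XR) : sin (2 * pi * angle (y + y') x) =
  cos (2 * pi * angle y x) * sin (2 * pi * angle y' x) +
  sin (2 * pi * angle y x) * cos (2 * pi * angle y' x) :> R.
Proof. by have := congr1 (@complex.Im R) (cis_angleD y y' x); rewrite /cis /= => ->. Qed.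

Let cosN (y : Y) (x : XR) : cos (2 * pi * angle (- y) x) = cos (2 * pi * angle y x) :> R.
Proof.
have := congr1 (@complex.Re R) (cis_angleN y x).
by rewrite /= mulrN trigo.cosN.
Qed.

Let sinN (y : Y) (x : XR) : sin (2 * pi * angle (- y) x) = - sin (2 * pi * angle y x) :> R.
Proof.
have := congr1 (@complex.Im R) (cis_angleN y x).
by rewrite /= mulrN trigo.sinN.
Qed.

Let agree_lin k1 k2 c1 c2 k : agree k1 -> agree k2 ->
  (forall x, k x = c1 * k1 x + c2 * k2 x) -> agree k.
Proof.
move=> [b1 h1] [b2 h2] /funext ->.
have lin (m : probability XR R) u : bounded_meas u ->
    E m (fun x => (c1 * k1 x + c2 * k2 x) * u x) =
    c1 * E m (fun x => k1 x * u x) + c2 * E m (fun x => k2 x * u x).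
  move=> bu; have b1u := bm_mul b1 bu; have b2u := bm_mul b2 bu.
  rewrite /E -!Rint_scale // -Rint_add; [|by apply: bm_mul => //; exact: bm_cst
    |by apply: bm_mul => //; exact: bm_cst].
  by apply: Rint_eq => x; ring.
split; first by apply: bm_add; apply: bm_mul => //; exact: bm_cst.
move=> y; rewrite !lin; [|exact: bs|exact: bs|exact: bc|exact: bc].
by rewrite (h1 y).1 (h2 y).1 (h1 y).2 (h2 y).2.
Qed.

(* Product-to-sum formulas: multiplying by a character permutes the pairings
   with characters. *)
Let agree_mul h k : trig h -> agree k -> agree (fun x => h x * k x).
Proof.
move=> th; elim: th k => {h} [c|z|z|g h _ IHg _ IHh|g h _ IHg _ IHh] k ak.
- by apply: (agree_lin (c1 := c) (c2 := 0) ak ak) => x; ring.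
- have [bk hk] := ak.
  have bcz := bm_mul (bc z) bk.
  split => // y; split.
  + have e (m : probability XR R) :
      E m (fun x => cos (2 * pi * angle z x) * k x * cos (2 * pi * angle y x)) =
      2^-1 * (E m (fun x => k x * cos (2 * pi * angle (y + z) x)) +
              E m (fun x => k x * cos (2 * pi * angle (y - z) x))).
      have [u1 u2] := (bm_mul bk (bc (y + z)), bm_mul bk (bc (y - z))).
      rewrite /E -Rint_add // -Rint_scale; last exact: bm_add.
      by apply: Rint_eq => x; rewrite !cosD cosN sinN; field.
    by rewrite !e (hk (y + z)).1 (hk (y - z)).1.
  + have e (m : probability XR R) :
      E m (fun x => cos (2 * pi * angle z x) * k x * sin (2 * pi * angle y x)) =
      2^-1 * (E m (fun x => k x * sin (2 * pi * angle (y + z) x)) +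
              E m (fun x => k x * sin (2 * pi * angle (y - z) x))).
      have [u1 u2] := (bm_mul bk (bs (y + z)), bm_mul bk (bs (y - z))).
      rewrite /E -Rint_add // -Rint_scale; last exact: bm_add.
      by apply: Rint_eq => x; rewrite !sinD cosN sinN; field.
    by rewrite !e (hk (y + z)).2 (hk (y - z)).2.
- have [bk hk] := ak.
  have bsz := bm_mul (bs z) bk.
  split => // y; split.
  + have e (m : probability XR R) :
      E m (fun x => sin (2 * pi * angle z x) * k x * cos (2 * pi * angle y x)) =
      2^-1 * (E m (fun x => k x * sin (2 * pi * angle (y + z) x)) -
              E m (fun x => k x * sin (2 * pi * angle (y - z) x))).
      have [u1 u2] := (bm_mul bk (bs (y + z)), bm_mul bk (bs (y - z))).
      rewrite /E -Rint_sub // -Rint_scale; last exact: bm_sub.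
      by apply: Rint_eq => x; rewrite !sinD cosN sinN; field.
    by rewrite !e (hk (y + z)).2 (hk (y - z)).2.
  + have e (m : probability XR R) :
      E m (fun x => sin (2 * pi * angle z x) * k x * sin (2 * pi * angle y x)) =
      2^-1 * (E m (fun x => k x * cos (2 * pi * angle (y - z) x)) -
              E m (fun x => k x * cos (2 * pi * angle (y + z) x))).
      have [u1 u2] := (bm_mul bk (bc (y + z)), bm_mul bk (bc (y - z))).
      rewrite /E -Rint_sub // -Rint_scale; last exact: bm_sub.
      by apply: Rint_eq => x; rewrite !cosD cosN sinN; field.
    by rewrite !e (hk (y + z)).1 (hk (y - z)).1.
- by apply: (agree_lin (c1 := 1) (c2 := 1) (IHg _ ak) (IHh _ ak)) => x; ring.
- apply: (agree_lin (c1 := 1) (c2 := 0) (IHg _ (IHh _ ak)) ak) => x; ring.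
Qed.

Lemma trig_eq h : trig h -> E mu h = E nu h.
Proof.
move=> th.
have a1 : agree (fun=> 1).
  split; first exact: bm_cst.
  move=> y; have [e1 e2] := mu_nu y.
  by split; rewrite /E; under eq_fun do rewrite mul1r.
have [_ /(_ 0) [e _]] := agree_mul th a1.
have r (m : probability XR R) :
    E m (fun x => h x * 1 * cos (2 * pi * angle (0 : Y) x)) = E m h.
  apply: Rint_eq => x.
  by have /= -> := congr1 (@complex.Re R) (@cis_angle0 R G q x); rewrite !mulr1.
by rewrite !r in e.
Qed.

Hypothesis qG : (#|G| %| q.+2)%N.

Local Notation gen := [set B : set XR | exists h c, trig h /\ B = [set x | c < h x]].

(* On the circle the interval (a, 1) is an arc centred at (1 + a) / 2, hence a
   superlevel set of a shifted cosine. *)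
Let itv_arc (t a : R) : 0 <= t < 1 -> 0 <= a < 1 ->
  (cos (pi * (1 - a)) < cos (2 * pi * (t - (1 + a) / 2))) = (a < t).
Proof.
move=> /andP[t0 t1] /andP[a0 a1].
(* The two cosines become those of a difference and a sum, so they differ by [2 * (sin (pi * (t -
   a)) * sin (pi * (1 - t)))]; the last factor is positive for [t] other than 0. *)
have -> : 2 * pi * (t - (1 + a) / 2) = pi * (t - a) - pi * (1 - t) by field.
have -> : pi * (1 - a) = pi * (t - a) + pi * (1 - t) by ring.
rewrite trigo.cosB trigo.cosD -subr_gt0.
have -> : forall x y : R, x + y - (x - y) = 2 * y by move=> x y; ring.
rewrite pmulr_rgt0 //.
have [tz|tz] := eqVneq t 0.
  by rewrite tz subr0 mulr1 sinpi mulr0 ltxx; apply/esym/negbTE; rewrite -leNgt.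
have t0' : 0 < t by rewrite lt_neqAle eq_sym tz.
rewrite pmulr_lgt0; last first.
  apply: sin_gt0_pi; rewrite mulr_gt0 ?pi_gt0 ?subr_gt0 //=.
  by rewrite -[ltRHS]mulr1 ltr_pM2l ?pi_gt0 // ltrBlDr ltrDl.
have pos u : 0 < u < 1 -> 0 < sin (pi * u) :> R.
  move=> /andP[u0 u1]; apply: sin_gt0_pi; rewrite mulr_gt0 ?pi_gt0 //=.
  by rewrite -[ltRHS]mulr1 ltr_pM2l ?pi_gt0.
case: (ltgtP a t) => [at_|ta|->]; last by rewrite subrr mulr0 sin0 ltxx.
- by apply: pos; lra.
- rewrite -opprB mulrN trigo.sinN oppr_gt0; apply/negbTE; rewrite -leNgt ltW //.
  by apply: pos; lra.
Qed.

(** [X] with the sigma-algebra on which [mu] and [nu] agree. Once both coordinates are measurable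
    from [T], it contains every measurable set of [X]. *)
Let T := g_sigma_algebraType gen.

Let gen_gt h c : trig h -> measurable ([set x | c < h x] : set T).
Proof. by move=> th; apply: sub_sigma_algebra; exists h, c. Qed.

Let meas_solv r : measurable_fun setT (fun x : T => solv (x : XR).1 r).
Proof.
apply: (measurability _ (RGenOInfty.measurableE R)) => //.
move=> _ [_ [a ->] <-]; rewrite setTI.
have lt01 (x : T) : 0 <= solv (x : XR).1 r < 1 by exact: (Defs.solP (x : XR).1).1.
have [a0|a0] := ltP a 0.
  rewrite [z in measurable z](_ : _ = setT) //; apply/seteqP; split=> // x _ /=.
  by rewrite in_itv /= andbT (lt_le_trans a0) //; case/andP: (lt01 x).
have [a1|a1] := leP 1 a.
  rewrite [z in measurable z](_ : _ = set0) //; apply/seteqP; split=> // x /=.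
  rewrite in_itv /= andbT => /(le_lt_trans a1); have /andP[_ h] := lt01 x.
  by move=> /(lt_trans h); rewrite ltxx.
rewrite [z in measurable z](_ : _ = [set x : T | cos (pi * (1 - a)) <
   cos (2 * pi * (angle ((r, 0) : Y) x - (1 + a) / 2))]).
  exact: (gen_gt _ (trig_shift (r, 0) ((1 + a) / 2))).
have e (x : T) : angle ((r, 0) : Y) x = solv (x : XR).1 r.
  by rewrite /angle /X_angle /= dual0l /zang mul0r addr0.
apply/seteqP; split=> x /=; rewrite in_itv /= andbT e itv_arc ?a0 //.
Qed.

Let meas_snd : measurable_fun setT (fun x : T => (x : XR).2).
Proof.
apply: measurable_discr => g.
(* A character separating [h] from [g] yields a superlevel set that contains the fibre over [g] and
   misses the one over [h]. The fibre over [g] is the finite intersection of these sets. *)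
have sep (h : G) : exists A : set T, [/\ measurable A, forall x : T, (x : XR).2 = g -> A x &
    h != g -> forall x : T, (x : XR).2 = h -> ~ A x].
  have [->|hg] := eqVneq h g; first by exists setT.
  have [|chi chiD chi0] := @finZmod_char_separates G q (h - g) qG; first by rewrite subr_eq0.
  pose psi := mk_dual chiD.
  have psi_neq : psi h != psi g.
    rewrite !mk_dualE; apply: contra chi0 => /eqP e.
    have := chiD (h - g) g; rewrite subrK e -{1}[chi g]add0r => /addIr <-.
    by [].
  pose c := cos (2 * pi * (zang R (psi h) - zang R (psi g))).
  have c1 : c < 1.
    rewrite lt_neqAle cos_le1 andbT; apply: contra psi_neq => /eqP c1.
    apply/eqP/(@cis_zang_inj R q).
    have : cis (zang R (psi h) - zang R (psi g)) = 1.
      rewrite /cis -/c c1.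
      suff -> : sin (2 * pi * (zang R (psi h) - zang R (psi g))) = 0 by [].
      by apply: cos1sin0; rewrite -/c c1 normr1.
    by rewrite cisD cisV => /divr1_eq.
  exists [set x : T | c < cos (2 * pi * (angle ((0, psi) : Y) x - zang R (psi g)))].
  have a0 (x : T) : cos (2 * pi * (angle ((0, psi) : Y) x - zang R (psi g))) =
      cos (2 * pi * (zang R (psi (x : XR).2) - zang R (psi g))).
    apply: (congr1 (@complex.Re R) (x := cis _) (y := cis _)).
    rewrite !cisD; congr (_ * _); rewrite /=.
    have -> : solv (x : XR).1 0 = 0.
      have [h1 h2] := Defs.solP (x : XR).1.
      have := h2 0 0; rewrite addr0 subrr sub0r rpredN => /intrP[m em].
      have := h1 0; rewrite em ler0z -[1]/(1%:~R) ltr_int; case: m {em} => [[|n]|n] //.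
    by rewrite cis0 mul1r.
  split.
  - exact: (gen_gt _ (trig_shift (0, psi) (zang R (psi g)))).
  - by move=> x xg /=; rewrite a0 xg subrr mulr0 cos0.
  - by move=> _ x xh /=; rewrite a0 xh ltxx.
pose A h := sval (cid (sep h)).
have AP h := svalP (cid (sep h)).
rewrite [z in measurable z](_ : _ = \bigcap_(h in [set: G]) A h).
  apply: fin_bigcap_measurable; first exact: finite_finset.
  by move=> h _; case: (AP h).
apply/seteqP; split=> x /=.
  by move=> xg h _; case: (AP h) => _ + _; apply.
move=> xA; apply: contrapT => /eqP xg; have [_ _ /(_ xg x erefl)] := AP (x : XR).2.
by apply; exact: xA.
Qed.

Lemma X_unique A : measurable A -> mu A = nu A.
Proof.
move=> mA.
apply: (algebra_unique (K := trig) trig_bm trig_cst trig_add trig_mul trig_eq).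
have mid : measurable_fun setT (fun x : T => (x : XR)).
  apply/measurable_fun_pairP; split; last exact: meas_snd.
  by apply: measurable_to_sol => r; exact: meas_solv.
by have := mid measurableT A mA; rewrite setTI.
Qed.
End Trig.

(** * The Heyde equation for characteristic functions *)

Lemma cexp_eq_measure d (T : measurableType d) (R : realType) (m1 m2 : probability T R) t :
  (forall A, measurable A -> m1 A = m2 A) -> cexp m1 t = cexp m2 t.
Proof.
move=> h; rewrite /cexp /Rintegral.
by congr (fine _ +i* fine _); apply: eq_measure_integral => A mA _; exact: h.
Qed.

Lemma cexp_dirac d (T : measurableType d) (R : realType) (a : T) (t : T -> R) :
  measurable_fun setT t -> cexp (\d_a : probability T R) t = cis (t a).
Proof.
move=> mt; rewrite /cexp /Rintegral /cis.
congr (_ +i* _); rewrite integral_dirac ?diracT ?mul1e //; apply/measurable_EFinP.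
  exact: (bm_cos2pi mt).1.
exact: (bm_sin2pi mt).1.
Qed.

Lemma ae_exists d (T : measurableType d) (R : realType) (m : probability T R) (Q : T -> Prop) :
  {ae m, forall x, Q x} -> exists x, Q x.
Proof.
move=> [N [mN N0 sN]]; apply: contrapT => nQ.
have NT : N = setT.
  by apply/seteqP; split=> // x _; apply: sN => Qx; apply: nQ; exists x.
have := probability_setT m; rewrite -NT N0 => /eqP; rewrite eq_sym.
by rewrite onee_eq0.
Qed.

(** By the pigeonhole principle two iterates coincide, so iteration is periodic from [i] on with
    period [dd]. A positive multiple of [dd] that is at least [i] serves as [e]. *)
Lemma iter_idempotent (T : finType) (f : T -> T) :
  exists2 e, (0 < e)%N & forall x, iter e f (iter e f x) = iter e f x.
Proof.
pose F (i : 'I_#|{ffun T -> T}|.+1) := [ffun x => iter i f x].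
have [/injectiveP injF|/injectivePn[i [j ij Fij]]] := boolP (injectiveb F).
  by have := leq_card F injF; rewrite card_ord ltnn.
wlog lt_ij : i j ij Fij / (i < j)%N.
  move=> wl; case: (ltngtP i j) => [|lt|/val_inj e]; first exact: wl.
    by apply: (wl j i) => //; rewrite eq_sym.
  by rewrite e eqxx in ij.
have Fx x : iter i f x = iter j f x by move/ffunP/(_ x): Fij; rewrite !ffunE.
pose dd := (j - i)%N.
have per n x : (i <= n)%N -> iter (n + dd) f x = iter n f x.
  move=> le_in; rewrite -(subnK le_in) -addnA /dd (subnKC (ltnW lt_ij)).
  by rewrite !iterD Fx.
have perm k n x : (i <= n)%N -> iter (n + k * dd) f x = iter n f x.
  move=> le_in; elim: k => [|k IH]; first by rewrite mul0n addn0.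
  by rewrite mulSn [(dd + _)%N]addnC addnA per ?IH // (leq_trans le_in) ?leq_addr.
have d0 : (0 < dd)%N by rewrite subn_gt0.
exists (i.+1 * dd)%N; first by rewrite muln_gt0.
move=> x; rewrite -iterD perm //.
by rewrite (leq_trans (leqnSn i)) // leq_pmulr.
Qed.

Section CharFun.
Variables (R : realType) (G : finZmodType) (q : nat).
Local Notation Y := (rat * dual G q)%type.
Local Notation XR := (X R G).

Definition charfun (mu : probability XR R) (y : Y) : R[i] := cexp mu (angle y).

Lemma charfun_like_charfun (mu : probability XR R) :
  (forall r chi, is_charG chi -> ~ charfun_vanishes_at mu r chi) ->
  charfun_like (charfun mu).
Proof.
move=> nv; have ma (y : Y) := @measurable_angle R G q y.
split.
- rewrite -(cis0 R) -(cexp_cst mu); apply: cexp_eq => x.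
  by rewrite cis_angle0 cis0.
- move=> [r chi]; apply/eqP => f0; apply: (nv r _ (is_charG_dual R chi)).
  have [c0 s0] : Rintegral mu setT (fun x => cos (2 * pi * angle (r, chi) x)) = 0 /\
     Rintegral mu setT (fun x => sin (2 * pi * angle (r, chi) x)) = 0.
    by split; [exact: (congr1 (@complex.Re R) f0) | exact: (congr1 (@complex.Im R) f0)].
  split.
    have := Rint_EFin mu (bm_cos2pi (ma (r, chi))); rewrite c0; exact.
  have := Rint_EFin mu (bm_sin2pi (ma (r, chi))); rewrite s0; exact.
- move=> y; rewrite /charfun -[RHS](cexpN _ (ma y)); apply: cexp_eq => x.
  exact: cis_angleN.
- by move=> y; exact: cexp_le1.
- move=> y z h; rewrite /charfun -cexp_unit //; apply: cexp_eq => x.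
  by rewrite cis_angleD cisD.
Qed.

Lemma measurable_X_add_pair : measurable_fun setT (fun p : XR * XR => X_add p.1 p.2).
Proof. exact: measurable_X_add. Qed.

Definition conv_prob (m1 m2 : probability XR R) : probability XR R :=
  push_prob (m1 \x m2)%E measurable_X_add_pair.

Lemma X_convE (m1 m2 : probability XR R) : X_conv m1 m2 = conv_prob m1 m2.
Proof.
apply/funext => A; rewrite /X_conv /=; congr ((m1 \x m2)%E _).
by apply/seteqP; split=> p /=; rewrite inE.
Qed.

Lemma charfun_conv m1 m2 y : charfun (conv_prob m1 m2) y = charfun m1 y * charfun m2 y.
Proof.
have ma := @measurable_angle R G q y.
rewrite /charfun cexp_push // -cexp_prod //; apply: cexp_eq => p /=.
by rewrite cis_angle_add cisD.
Qed.

Lemma charfun_dirac x y : charfun (\d_x : probability XR R) y = cis (angle y x).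
Proof. by rewrite /charfun cexp_dirac //; exact: measurable_angle. Qed.

Lemma charfun_inj (qG : (#|G| %| q.+2)%N) (m1 m2 : probability XR R) :
  charfun m1 =1 charfun m2 -> forall A, measurable A -> m1 A = m2 A.
Proof. by move=> h A mA; apply: (X_unique h qG). Qed.

Section Independent.
Context d (Omega : measurableType d) (P : probability Omega R).
Variables (xi1 xi2 : Omega -> XR) (mu1 mu2 : probability XR R).
Hypotheses (mxi1 : measurable_fun setT xi1) (mxi2 : measurable_fun setT xi2).
Hypothesis indep : forall A B : set XR, measurable A -> measurable B ->
     P (xi1 @^-1` A `&` xi2 @^-1` B) = (P (xi1 @^-1` A) * P (xi2 @^-1` B))%E.
Hypothesis hmu1 : forall A : set XR, measurable A -> mu1 A = P (xi1 @^-1` A).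
Hypothesis hmu2 : forall A : set XR, measurable A -> mu2 A = P (xi2 @^-1` A).

Lemma cexp_indep (y z : Y) :
  cexp P (fun w => angle y (xi1 w) + angle z (xi2 w)) = charfun mu1 y * charfun mu2 z.
Proof.
have mxi := measurable_fun_pair mxi1 mxi2.
have [my mz] := (@measurable_angle R G q y, @measurable_angle R G q z).
rewrite /charfun -cexp_prod //.
have mt : measurable_fun setT (fun p : XR * XR => angle y p.1 + angle z p.2).
  by apply: measurable_funD; exact: measurableT_comp.
transitivity (cexp (push_prob P mxi) (fun p => angle y p.1 + angle z p.2)).
  by rewrite cexp_push.
apply: cexp_eq_measure => A mA; apply/esym.
apply: (product_measure_unique (m' := push_prob P mxi)) => // B C mB mC.
transitivity (P (xi1 @^-1` B) * P (xi2 @^-1` C))%E; first exact: indep.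
by congr (_ * _)%E; apply/esym; [exact: hmu1 | exact: hmu2].
Qed.

Variables (a : rat) (alphaG : G -> G).
Hypothesis alphaG_add : {morph alphaG : x y / x + y}.
Hypothesis symm : forall C : set (XR * XR), measurable C ->
     P ((fun w => (X_add (xi1 w) (xi2 w),
                   X_add (xi1 w) (X_aut a alphaG (xi2 w)))) @^-1` C)
     = P ((fun w => (X_add (xi1 w) (xi2 w),
                     X_opp (X_add (xi1 w) (X_aut a alphaG (xi2 w))))) @^-1` C).

Let b := dual_aut a (@dual_comp G q alphaG alphaG_add).

(** The pair of characters [u], [v] evaluated at [(L1, L2)] is [u + v] at [xi1] times [u + b v] at
    [xi2]; replacing [L2] by its opposite changes the sign of [v]. Independence factors both
    expectations. *)
Lemma charfun_heyde (u v : Y) :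
  charfun mu1 (u + v) * charfun mu2 (u + b v) =
  charfun mu1 (u - v) * charfun mu2 (u - b v).
Proof.
have m1 := measurable_X_add mxi1 mxi2.
have m2 := measurable_X_add mxi1 (measurable_X_aut a alphaG mxi2).
have mL := measurable_fun_pair m1 m2.
have mL' := measurable_fun_pair m1 (measurable_X_opp m2).
have [mu_ mv] := (@measurable_angle R G q u, @measurable_angle R G q v).
have mt : measurable_fun setT (fun p : XR * XR => angle u p.1 + angle v p.2).
  by apply: measurable_funD; exact: measurableT_comp.
have key := cexp_eq_measure (m1 := push_prob P mL) (m2 := push_prob P mL')
  (fun p => angle u p.1 + angle v p.2) symm.
rewrite !cexp_push // in key.
rewrite -!cexp_indep.
transitivity (cexp P ((fun p : XR * XR => angle u p.1 + angle v p.2) \o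
   (fun w => (X_add (xi1 w) (xi2 w), X_add (xi1 w) (X_aut a alphaG (xi2 w)))))).
  apply: cexp_eq => w /=.
  rewrite !(cisD (angle _ _)) !cis_angleD !cis_angle_add cis_angle_aut /b /dual_aut; ring.
rewrite key; apply: cexp_eq => w /=.
rewrite !(cisD (angle _ _)) !cis_angleD !cis_angleN cis_angle_opp !cisV !cis_angle_add cis_angle_aut.
by rewrite /b /dual_aut invfM; ring.
Qed.
End Independent.
End CharFun.

(** * Reconstruction of the distributions *)

Section Finish.
Variables (R : realType) (G : finZmodType) (q : nat).
Hypothesis qG : (#|G| %| q.+2)%N.
Local Notation Y := (rat * dual G q)%type.
Local Notation XR := (X R G).

Lemma cis_angle0l (chi : dual G q) (x : XR) : cis (angle (0, chi) x) = cis (zang R (chi x.2)).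
Proof.
have s0 := cis_solD x.1 0 0; rewrite addr0 in s0.
have {}s0 : cis (solv x.1 0) = 1.
  by apply: (mulfI (cis_neq0 (solv x.1 0))); rewrite -s0 mulr1.
by rewrite cis_angle /= s0 mul1r.
Qed.

Lemma dual_separates (g h : G) : (forall chi : dual G q, chi g = chi h) -> g = h.
Proof.
move=> e; apply/eqP/negPn/negP => gh.
have [|chi chiD] := @finZmod_char_separates G q (g - h) qG; first by rewrite subr_eq0.
have := e (mk_dual chiD); rewrite !mk_dualE => {}e.
have := chiD (g - h) h; rewrite subrK e -{1}[chi h]add0r => /addIr <-.
by rewrite eqxx.
Qed.

Section Support.
Variables (mu : probability XR R) (B : G -> G).
Hypothesis BD : {morph B : x y / x + y}.
Hypothesis unitB : forall chi : dual G q, `|charfun mu (0, dual_comp BD chi)| = 1.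

Let ae_unit : {ae mu, forall x : XR, forall chi : dual G q,
  cis (zang R (chi (B x.2))) = charfun mu (0, dual_comp BD chi)}.
Proof.
apply: filter_forall => chi.
have := cexp_unit_ae (@measurable_angle R G q (0, dual_comp BD chi)) (unitB chi).
apply: filterS => x; rewrite -[cexp _ _]/(charfun mu _) => <-.
by rewrite cis_angle0l dual_compE.
Qed.

(** Modulus 1 makes each [chi (B x.2)] almost surely constant. There are finitely many [chi] and
    they separate points, so [B x.2] is almost surely constant; [g0] is the finite component of a
    point outside the null set. *)
Lemma support_coset : exists g0 : G,
  [/\ mu [set x : XR | B x.2 = B g0] = 1%E &
      forall chi : dual G q, charfun mu (0, dual_comp BD chi) = cis (zang R (chi (B g0)))].
Proof.
have [x0 hx0] := ae_exists ae_unit; exists x0.2; split => //.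
have mA : measurable [set x : XR | B x.2 = B x0.2].
  have := @measurable_snd _ _ (Sol R) (discr G) measurableT [set g : discr G | B g = B x0.2].
  by rewrite setTI; apply.
have ae : {ae mu, forall x : XR, B x.2 = B x0.2}.
  apply: filterS ae_unit => x hx; apply: dual_separates => chi.
  by apply: (@cis_zang_inj R q); rewrite hx hx0.
have n0 : mu (~` [set x : XR | B x.2 = B x0.2]) = 0%E.
  by apply: measure_negligible => //; exact: measurableC.
have := probability_setC mu (measurableC mA).
by rewrite setCK n0 sube0.
Qed.
End Support.

Section Gaussian.
Variable mu : probability XR R.

Let mfst : measurable_fun setT (fst : XR -> Sol R) := measurable_fst.

Definition sol_marginal : probability (Sol R) R := push_prob mu mfst.

Lemma charfun_sol_marginal r :
  cexp sol_marginal (fun x => solv x r) = charfun mu ((r, 0) : Y).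
Proof.
rewrite /sol_marginal cexp_push; last exact: measurable_solv.
apply: cexp_eq => x; rewrite cis_angle /= dual0l /zang mul0r cis0 mulr1.
by [].
Qed.

Lemma sol_marginal_gaussian (z : Sol R) (sigma : R) : 0 <= sigma ->
  (forall r, charfun mu ((r, 0) : Y) = cis (solv z r) * (expR (- sigma * ratr r ^+ 2))%:C) ->
  gaussian_sol sol_marginal.
Proof.
move=> s0 h; exists z, sigma; split => // r.
have e := h r; rewrite -charfun_sol_marginal in e.
have mr := @measurable_solv R r.
split.
- rewrite (Rint_EFin _ (bm_cos2pi mr)).
  rewrite -[Rintegral _ _ _]/(complex.Re (cexp sol_marginal (fun x => solv x r))) e /cis /=.
  by rewrite mulr0 subr0.
- rewrite (Rint_EFin _ (bm_sin2pi mr)).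
  rewrite -[Rintegral _ _ _]/(complex.Im (cexp sol_marginal (fun x => solv x r))) e /cis /=.
  by rewrite mulr0 add0r.
Qed.

Lemma measurable_embed : measurable_fun setT (@sol_embed R G).
Proof. by apply: measurable_fun_pair => //; exact: measurable_cst. Qed.

Definition embed_prob (m : probability (Sol R) R) : probability XR R :=
  push_prob m measurable_embed.

Lemma charfun_embed_marginal (y : Y) :
  charfun (embed_prob sol_marginal) y = charfun mu ((y.1, 0) : Y).
Proof.
rewrite /charfun /embed_prob cexp_push; last exact: measurable_angle.
rewrite -[RHS]charfun_sol_marginal; apply: cexp_eq => x /=.
by rewrite cis_angle /= dual0r /zang mul0r cis0 mulr1.
Qed.
End Gaussian.

Lemma sol_of_character (u : rat -> R[i]) : (forall r, `|u r| = 1) ->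
  {morph u : r s / r + s >-> r * s} -> exists z : Sol R, forall r, cis (solv z r) = u r.
Proof.
move=> u1 uD.
pose v r := s2val (cid2 (cis_surj (u1 r))).
have v01 r : 0 <= v r < 1 by exact: s2valP (cid2 (cis_surj (u1 r))).
have vE r : cis (v r) = u r by exact: s2valP' (cid2 (cis_surj (u1 r))).
have vs : is_sol v.
  split=> // r s; apply: cis_eq1; rewrite !cisD !cisV !vE uD.
  have u0 t : u t != 0 by rewrite -vE cis_neq0.
  by field; rewrite !u0.
by exists (Solenoid vs).
Qed.

Lemma measurable_translate (f : XR -> Sol R) (c : G) : measurable_fun setT f ->
  measurable_fun setT (fun x : XR => (f x, (x.2 : G) - c : G) : XR).
Proof.
move=> mf; apply: measurable_fun_pair => //.
exact: (measurableT_comp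
  (@measurable_from_discr _ _ _ (fun g : discr G => (g : G) - c : discr G)) measurable_snd).
Qed.

(** Covers both choices of [om]: [f] is constant when [a] differs from [-1], and the first
    projection when [a = -1]. *)
Definition translate_prob (mu : probability XR R) (f : XR -> Sol R) (mf : measurable_fun setT f)
  (c : G) : probability XR R := push_prob mu (measurable_translate c mf).

Lemma cis_dualB (chi : dual G q) (g h : G) :
  cis (zang R (chi (g - h))) = cis (zang R (chi g)) * cis (- zang R (chi h)).
Proof.
rewrite cisV; apply: (mulIf (cis_neq0 (zang R (chi h)))).
by rewrite -cis_zangD -dualM subrK mulfVK ?cis_neq0.
Qed.

Lemma charfun_translate mu f (mf : measurable_fun setT f) c (y : Y) :
  charfun (translate_prob mu mf c) y =
  cexp mu (fun x => angle y ((f x, x.2) : XR)) * cis (- zang R (y.2 c)).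
Proof.
rewrite /charfun /translate_prob cexp_push; last exact: measurable_angle.
rewrite -cexp_shift.
  apply: cexp_eq => x.
  by rewrite (cisD (angle _ _)) /= !cis_angle /= cis_dualB mulrA.
apply: (measurableT_comp (measurable_angle y)).
by apply: measurable_fun_pair.
Qed.
End Finish.

Unset Implicit Arguments. Set Strict Implicit. Set Printing Implicit Defensive.
Local Close Scope complex_scope.

Theorem theorem4p1 (R : realType) (G : finZmodType)
  (* G contains no elements of order 2 *)
  (noorder2 : forall g : G, g + g = 0 -> g = 0)
  (* the topological automorphism alpha(z, g) = (a z, alphaG g) of X *)
  (a : rat) (a_neq0 : a != 0)
  (alphaG : G -> G)
  (alphaG_add : forall g h : G, alphaG (g + h) = alphaG g + alphaG h)
  (alphaG_bij : bijective alphaG)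
  (* independent X-valued random variables xi1, xi2 *)
  (d : measure_display) (Omega : measurableType d) (P : probability Omega R)
  (xi1 xi2 : Omega -> X R G)
  (mxi1 : measurable_fun [set: Omega] xi1)
  (mxi2 : measurable_fun [set: Omega] xi2)
  (indep : forall A B : set (X R G), measurable A -> measurable B ->
     P (xi1 @^-1` A `&` xi2 @^-1` B) = (P (xi1 @^-1` A) * P (xi2 @^-1` B))%E)
  (* with distributions mu1, mu2 *)
  (mu1 mu2 : probability (X R G) R)
  (hmu1 : forall A : set (X R G), measurable A -> mu1 A = P (xi1 @^-1` A))
  (hmu2 : forall A : set (X R G), measurable A -> mu2 A = P (xi2 @^-1` A))
  (* whose characteristic functions vanish nowhere on the character group *)
  (nv1 : forall (r : rat) (chi : G -> R), is_charG chi ->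
     ~ charfun_vanishes_at mu1 r chi)
  (nv2 : forall (r : rat) (chi : G -> R), is_charG chi ->
     ~ charfun_vanishes_at mu2 r chi)
  (* the conditional distribution of L2 = xi1 + alpha xi2 given
     L1 = xi1 + xi2 is symmetric: (L1, L2) and (L1, -L2) are equidistributed *)
  (symm : forall C : set (X R G * X R G), measurable C ->
     P ((fun w => (X_add (xi1 w) (xi2 w),
                   X_add (xi1 w) (X_aut a alphaG (xi2 w)))) @^-1` C)
     = P ((fun w => (X_add (xi1 w) (xi2 w),
                     X_opp (X_add (xi1 w) (X_aut a alphaG (xi2 w))))) @^-1` C)) :
  let K : set G := [set g | g + alphaG g = 0] in
  (a != -1 ->
     exists (gam1 gam2 : probability (Sol R) R) (om : probability (X R G) R)
            (x1 x2 : X R G),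
       [/\ gaussian_sol gam1, gaussian_sol gam2,
           (* om is supported in the subgroup {0} x K of X *)
           om [set x : X R G | x.1 = sol0 R /\ K x.2] = 1%E,
           (forall A : set (X R G), measurable A ->
              mu1 A = X_conv (X_conv (pushforward gam1 (@sol_embed R G)) om)
                             (\d_x1) A) &
           (forall A : set (X R G), measurable A ->
              mu2 A = X_conv (X_conv (pushforward gam2 (@sol_embed R G)) om)
                             (\d_x2) A)]) /\
  (a = -1 ->
     exists (om : probability (X R G) R) (x1 x2 : X R G),
       [/\ (* om is supported in Sigma_a x K *)
           om [set x : X R G | K x.2] = 1%E,
           (forall A : set (X R G), measurable A ->
              mu1 A = X_conv om (\d_x1) A) &
           (forall A : set (X R G), measurable A ->
              mu2 A = X_conv om (\d_x2) A)]).
Proof.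
(* The factor 2 keeps the modulus [q.+2] at least 2 even for trivial [G]. *)
pose q := (#|G| * 2).-2.
have G0 : (0 < #|G|)%N by apply/card_gt0P; exists 0.
have qE : q.+2 = (#|G| * 2)%N by rewrite /q; case: #|G| G0.
have qG : (#|G| %| q.+2)%N by rewrite qE dvdn_mulr.
have aD : {morph alphaG : x y / x + y} by [].
have cf1 := charfun_like_charfun q nv1.
have cf2 := charfun_like_charfun q nv2.
have heyde := charfun_heyde (q := q) mxi1 mxi2 indep hmu1 hmu2 aD symm.
pose dbl (g : G) := g + g.
have dbl_inj : injective dbl.
  move=> g h e; apply/eqP; rewrite -subr_eq0; apply/eqP/noorder2.
  by rewrite addrACA -opprD [g + g]e subrr.
have [half dblK halfK] := injF_bij dbl_inj.
have halfD : {morph half : x y / x + y}.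
  by move=> x y; apply: dbl_inj; rewrite halfK /dbl addrACA -!/(dbl _) !halfK.
have [ainv aK Ka] := alphaG_bij.
have ainvD : {morph ainv : x y / x + y}.
  by move=> x y; apply: (can_inj aK); rewrite aD !Ka.
pose bH := @dual_comp G q alphaG aD.
pose halfH := @dual_comp G q half halfD.
have bHD : {morph bH : x y / x + y} := @dual_compD G q alphaG aD.
have halfHD : {morph halfH : x y / x + y} := @dual_compD G q half halfD.
have halfHK x : halfH x + halfH x = x.
  by apply: dual_eq => g; rewrite dualD !dual_compE -dualM -/(dbl _) halfK.
have bH_surj y : exists x, bH x = y.
  by exists (dual_comp ainvD y); apply: dual_eq => g; rewrite !dual_compE aK.
have [e e0 he] := iter_idempotent (fun h : dual G q => h - bH h).
have nH := @dual_mulrn_card G q.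
pose B (g : G) := g + alphaG g.
have BD : {morph B : x y / x + y} by move=> x y; rewrite /B aD addrACA.
have dBE (chi : dual G q) : dual_comp BD chi = chi + bH chi.
  by apply: dual_eq => g; rewrite dualD !dual_compE dualM.
have unitB (chi : dual G q) : `|charfun mu2 (0, dual_comp BD chi)| = 1.
  rewrite dBE.
  exact: (heyde_product_unit cf1 cf2 a_neq0 bHD halfHD halfHK G0 nH bH_surj e0 he heyde).
have [g0 [muB fB]] := support_coset qG unitB.
pose c := B g0.
(* On these characters [mu1] looks like [mu2] translated by [- c]; the squared denominator at the
   halved character is the value of [chi] at [c]. *)
have f12 r (chi : dual G q) : r / 2 + a * (r / 2) = 0 ->
    charfun mu1 (r, chi) = charfun mu2 (r, chi) * cis (- zang R (chi c)).
  move=> hr.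
  have := heyde_product_double cf1 cf2 a_neq0 bHD halfHD halfHK G0 nH bH_surj e0 he heyde
    (x := (r / 2, halfH chi)) hr.
  have -> : (r / 2, halfH chi) + (r / 2, halfH chi) = (r, chi).
    by congr (_, _) => /=; [field | exact: halfHK].
  move=> ->; rewrite /= -dBE fB expr2 -cis_zangD -dualD halfHK.
  by rewrite cisV.
have cis_sol0 y g : cis (angle (y : rat * dual G q) ((sol0 R, g) : X R G)) =
    cis (zang R (y.2 g)) by rewrite cis_angle /= cis0 mul1r.
(* [om] is built from [mu2] shifted by [- g0], which [x2] undoes; [x1] carries in addition the shift
   by [- c] from [f12]. *)
pose x1 : X R G := (sol0 R, g0 - c : G).
pose x2 : X R G := (sol0 R, g0 : G).
have KE (x : X R G) : ((x.2 : G) - g0) + alphaG ((x.2 : G) - g0) = 0 <-> B x.2 = B g0.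
  rewrite -/(B (_ - g0)); split=> [e1|e1].
    by rewrite -(subrK g0 (x.2 : G)) BD e1 add0r.
  apply: (addIr (B g0)).
  by rewrite -BD subrK add0r.
split=> [aN1|aN1].
- have sp1 := heyde_product_split1 cf1 cf2 a_neq0 bHD halfHD halfHK G0 nH bH_surj e0 he heyde aN1.
  have sp2 := heyde_product_split2 cf1 cf2 a_neq0 bHD halfHD halfHK G0 nH bH_surj e0 he heyde aN1.
  have [s1 [s2 [u [[s10 s20] u1 uD f1E f2E]]]] :=
    heyde_product_gaussian cf1 cf2 a_neq0 bHD halfHD halfHK bH_surj e0 he heyde aN1.
  have [z zE] := sol_of_character u1 uD.
  pose om := translate_prob mu2 (measurable_cst (sol0 R : Sol R)) g0.
  have omE y : charfun om y = charfun mu2 (0, y.2) * cis (- zang R ((y : rat * dual G q).2 g0)).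
    rewrite charfun_translate; congr (_ * _); apply: cexp_eq => x.
    by rewrite cis_sol0 cis_angle0l.
  exists (sol_marginal mu1), (sol_marginal mu2), om, x1, x2; split.
  + apply: (sol_marginal_gaussian (q := q) (z := sol_scale (- a) z) s10) => r.
    by rewrite zE f1E.
  + apply: (sol_marginal_gaussian (q := q) (z := z) s20) => r.
    by rewrite zE f2E.
  + rewrite -muB; congr (mu2 _); apply/seteqP; split=> x /=.
      by case=> _ /KE.
    by move=> /KE.
  + move=> A mA; rewrite -[pushforward _ _]/(embed_prob G (sol_marginal mu1) : set _ -> _) !X_convE.
    apply: (charfun_inj qG) mA => -[r chi].
    rewrite !charfun_conv charfun_embed_marginal omE charfun_dirac cis_sol0 /= cis_dualB.
    (* Only the finite component of [mu1] is compared with [mu2], by [f12] at the rational character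
       0; the rational component is the marginal itself. *)
    rewrite (sp1 r chi) (f12 0 chi) ?mul0r ?mulr0 ?addr0 // (cisV (zang R (chi g0))).
    by field; rewrite cis_neq0.
  + move=> A mA; rewrite -[pushforward _ _]/(embed_prob G (sol_marginal mu2) : set _ -> _) !X_convE.
    apply: (charfun_inj qG) mA => -[r chi].
    rewrite !charfun_conv charfun_embed_marginal omE charfun_dirac cis_sol0 /=.
    rewrite sp2 cisV.
    by field; rewrite cis_neq0.
(* For [a = -1] the condition in [f12] holds at every [r], so [mu1] and [mu2] are translates of each
   other. *)
- pose om := translate_prob mu2 (@measurable_fst _ _ (Sol R) (discr G)) g0.
  have omE y : charfun om y = charfun mu2 y * cis (- zang R ((y : rat * dual G q).2 g0)).
    by rewrite charfun_translate.
  exists om, x1, x2; split.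
  + rewrite -muB; congr (mu2 _); apply/seteqP; split=> x /=.
      by move/KE.
    by move=> /KE.
  + move=> A mA; rewrite X_convE; apply: (charfun_inj qG) mA => -[r chi].
    rewrite charfun_conv omE charfun_dirac cis_sol0 /= cis_dualB f12; last by rewrite aN1 mulN1r subrr.
    rewrite [in RHS](cisV (zang R (chi g0))).
    by field; rewrite cis_neq0.
  + move=> A mA; rewrite X_convE; apply: (charfun_inj qG) mA => -[r chi].
    rewrite charfun_conv omE charfun_dirac cis_sol0 /= cisV.
    by field; rewrite cis_neq0.
Qed.
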